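(* Let $\Lambda=kQ/I$ be a bound quiver algebra and let $X$ be a $\Lambda$-bimodule. For every $n\geq 1$: $$\dim_k \mathsf{HH}^n_\tau(\Lambda,X)=(-1)^n\Big(\sum_{i=0}^{n-1}(-1)^{i+1}\dim_k \mathsf{HH}^i(\Lambda,X)+\sum_{i=0}^{n}\ \sum_{x,y\in Q_0}(-1)^i\dim_k yXx\ \dim_k\mathrm{Tor}_i^\Lambda(k_y,{}_xk)\Big)$$ $$=(-1)^n\Big(\sum_{i=0}^{n-1}(-1)^{i+1}\dim_k \mathsf{HH}^i(\Lambda,X)+\sum_{i=0}^{n}\ \sum_{x,y\in Q_0}(-1)^i\dim_k yXx\ \dim_k\mathrm{Ext}^i_\Lambda({}_xk,{}_yk)\Big),$$ and $$\dim_k \mathsf{HH}_n^\tau(\Lambda,X)=(-1)^n\Big(\sum_{i=0}^{n-1}(-1)^{i+1}\dim_k \mathsf{HH}_i(\Lambda,X)+\sum_{i=0}^{n}\ \sum_{x,y\in Q_0}(-1)^i\dim_k yXx\ \dim_k\mathrm{Tor}_i^\Lambda(k_x,{}_yk)\Big)$$ $$=(-1)^n\Big(\sum_{i=0}^{n-1}(-1)^{i+1}\dim_k \mathsf{HH}_i(\Lambda,X)+\sum_{i=0}^{n}\ \sum_{x,y\in Q_0}(-1)^i\dim_k yXx\ \dim_k\mathrm{Ext}^i_\Lambda({}_yk,{}_xk)\Big).$$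
   Context: Let $k$ be a field. All modules and bimodules are finite dimensional over $k$; $D=\mathrm{Hom}_k(-,k)$; $\otimes=\otimes_k$. Bound quiver algebra: $Q$ is a finite quiver with vertex set $Q_0$ and arrow set $Q_1$, $F$ is the ideal of $kQ$ generated by the arrows, $I$ is an admissible ideal ($F^m\subset I\subset F^2$ for some $m\ge 2$), and $\Lambda=kQ/I$. Paths are composed from right to left, so vertices are idempotents and $y\Lambda x$ is spanned by the classes of paths from $x$ to $y$. For $x\in Q_0$, ${}_xk$ (resp. $k_x$) is the simple left (resp. right) $\Lambda$-module at $x$. $\Lambda$-bimodules are left $\Lambda\otimes\Lambda^{\mathrm{op}}$-modules; the subscript or superscript $\Lambda-\Lambda$ means over $\Lambda\otimes\Lambda^{\mathrm{op}}$. Hochschild (co)homology: $\mathsf{HH}^n(\Lambda,X)=\mathrm{Ext}^n_{\Lambda-\Lambda}(\Lambda,X)$, $\mathsf{HH}_n(\Lambda,X)=\mathrm{Tor}_n^{\Lambda-\Lambda}(X,\Lambda)$, $n\ge 0$. $\tau$-Hochschild (co)homology: $\Omega^{m}$ is the $m$-th syzygy of bimodules taken with minimal projective resolutions ($\Omega^0=\mathrm{id}$); $\mathrm{Tr}M$ is the transpose, i.e. the cokernel of $\mathrm{Hom}(P_0,\Lambda\otimes\Lambda^{\mathrm{op}})\to\mathrm{Hom}(P_1,\Lambda\otimes\Lambda^{\mathrm{op}})$ for a minimal projective presentation $P_1\to P_0\to M\to 0$; $\tau=D\,\mathrm{Tr}$ is the Auslander–Reiten translate for $\Lambda$-bimodules;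 $\tau_n=\tau\Omega^{n-1}$ for $n\ge1$. For $n\geq 1$: $\mathsf{HH}^n_\tau(\Lambda,X)=D\,\mathrm{Hom}_{\Lambda-\Lambda}(X,\tau_n\Lambda)$ and $\mathsf{HH}_n^\tau(\Lambda,X)=\mathrm{Hom}_{\Lambda-\Lambda}(DX,\tau_n\Lambda)$. *)

(* Defs.v *)
From HB Require Import structures.
From mathcomp Require Import all_boot all_algebra falgebra.
From mathcomp Require Import finmap boolp monalg.

Set Implicit Arguments.
Unset Strict Implicit.
Unset Printing Implicit Defensive.

Import GRing.Theory.
Local Open Scope ring_scope.

Definition vdim (k : fieldType) (V : vectType k) : nat := \dim {: V}.

(* V / U, realised on the chosen complement of U, with the projection along U. *)
Section QuotientSpace.
Variables (k : fieldType) (V : vectType k) (U : {vspace V}).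

Definition vquot : vectType k := subvs_of (U^C)%VS.

Definition vquot_proj : 'Hom(V, vquot) :=
  linfun (vsproj (U^C)%VS \o daddv_pi (U^C)%VS U).

Lemma vquot_projE v : vsval (vquot_proj v) = daddv_pi (U^C)%VS U v.
Proof. by rewrite lfunE /= vsprojK ?memv_pi. Qed.

Lemma vquot_projK v : v - vsval (vquot_proj v) \in U.
Proof.
rewrite vquot_projE.
have cap0 : (U^C :&: U = 0)%VS by rewrite capvC capv_compl.
have: v \in (U^C + U)%VS by rewrite addvC addv_complf memvf.
by move/(daddv_pi_add cap0) => {1}<-; rewrite addrC addKr memv_pi.
Qed.

Lemma vsvalQK (q : vquot) : vquot_proj (vsval q) = q.
Proof.
apply: val_inj; rewrite /= vquot_projE daddv_pi_id ?subvsP //.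
by rewrite capvC capv_compl.
Qed.

Lemma vquot_proj_eq0 v : (vquot_proj v == 0) = (v \in U).
Proof.
apply/eqP/idP => [v0 | Uv]; first by have:= vquot_projK v; rewrite v0 (linear0 vsval) subr0.
apply: val_inj; rewrite /=; apply/eqP; rewrite -memv0.
rewrite -(capv_compl U) memv_cap subvsP andbT.
by rewrite -[vsval _](subKr v) rpredB ?vquot_projK.
Qed.

Lemma limg_vquot_proj : limg vquot_proj = fullv.
Proof.
by apply/vspaceP => q; rewrite memvf -(vsvalQK q) memv_img ?memvf.
Qed.

End QuotientSpace.

(* Z / B for subspaces B <= Z, realised as a complement of B in Z. *)
Definition subquot (k : fieldType) (V : vectType k) (Z B : {vspace V}) :
  vectType k := subvs_of (Z :\: B)%VS.

(* V (x) W over k: matrices of coordinates in the bases vbasis {:V}, vbasis {:W}. *)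
Section TensorSpace.
Variable k : fieldType.
Implicit Types U V W : vectType k.

Definition vtens V W : Type := 'M[k]_(\dim {: V}, \dim {: W}).
HB.instance Definition _ V W := Vector.on (vtens V W).

Definition tens V W (v : V) (w : W) : vtens V W :=
  \matrix_(i, j) (coord (vbasis fullv) i v * coord (vbasis fullv) j w).

Definition tlift U V W (h : V -> W -> U) (t : vtens V W) : U :=
  \sum_i \sum_j (t : 'M_(_, _)) i j *: h (vbasis fullv)`_i (vbasis fullv)`_j.

Definition bilin U V W (h : V -> W -> U) :=
  (forall w, linear (h^~ w)) /\ (forall v, linear (h v)).

Lemma tlift_is_linear U V W (h : V -> W -> U) : linear (tlift h).
Proof.
move=> a s t; rewrite /tlift scaler_sumr -big_split; apply: eq_bigr => i _ /=.
rewrite scaler_sumr -big_split; apply: eq_bigr => j _ /=.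
by rewrite !mxE scalerDl scalerA.
Qed.
HB.instance Definition _ U V W (h : V -> W -> U) :=
  GRing.isLinear.Build k (vtens V W) U _ (tlift h) (tlift_is_linear h).

Lemma tens_linl V W (w : W) : linear (fun v : V => tens v w).
Proof. by move=> a u v; apply/matrixP => i j; rewrite !mxE linearP mulrDl mulrA. Qed.
Lemma tens_linr V W (v : V) : linear (fun w : W => tens v w).
Proof.
by move=> a u w; apply/matrixP => i j; rewrite !mxE linearP mulrDr mulrCA.
Qed.
HB.instance Definition _ V W (v : V) :=
  GRing.isLinear.Build k W (vtens V W) _ (tens v) (@tens_linr V W v).

Lemma tlift_linear_param (T : lmodType k) U V W (h : T -> V -> W -> U) (t : vtens V W) :
  (forall v w, linear (fun x => h x v w)) -> linear (fun x => tlift (h x) t).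
Proof.
move=> lh a x y; rewrite /tlift scaler_sumr -big_split; apply: eq_bigr => i _ /=.
rewrite scaler_sumr -big_split; apply: eq_bigr => j _ /=.
by rewrite lh scalerDr !scalerA mulrC.
Qed.

Lemma linear_sum_of (U V : lmodType k) (f : V -> U) : linear f ->
  forall I (r : seq I) (c : I -> k) (x : I -> V),
  f (\sum_(i <- r) c i *: x i) = \sum_(i <- r) c i *: f (x i).
Proof.
move=> lf I r c x; pose F : {linear V -> U} :=
  HB.pack f (GRing.isLinear.Build k V U _ f lf).
rewrite -[f]/(F : _ -> _) linear_sum; apply: eq_bigr => i _; exact: linearZ.
Qed.

Lemma tlift_tens U V W (h : V -> W -> U) v w : bilin h -> tlift h (tens v w) = h v w.
Proof.
move=> [hl hr].
rewrite {2}(coord_vbasis (memvf v)) (linear_sum_of (hl w)).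
rewrite /tlift; apply: eq_bigr => i _.
rewrite {2}(coord_vbasis (memvf w)) (linear_sum_of (hr _)) scaler_sumr.
by apply: eq_bigr => j _; rewrite mxE scalerA.
Qed.

Lemma tens_bilin V W : bilin (@tens V W).
Proof. by split; [apply: tens_linl | apply: tens_linr]. Qed.

Lemma tlift_id V W (t : vtens V W) : tlift (@tens V W) t = t.
Proof.
apply/matrixP => i j; rewrite /tlift summxE (bigD1 i) //= summxE (bigD1 j) //=.
rewrite !mxE !coord_free ?(basis_free (vbasisP _)) // !eqxx !mulr1.
rewrite big1 ?addr0 => [|j' /negPf ne]; last first.
  by rewrite !mxE !coord_free ?(basis_free (vbasisP _)) // ?(eq_sym j) ?ne ?mulr0.
rewrite big1 ?addr0 // => i' /negPf ne; rewrite summxE big1 // => j' _.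
rewrite !mxE !coord_free ?(basis_free (vbasisP _)) // ?(eq_sym i) ?ne.
by rewrite mul0r mulr0.
Qed.

Lemma eq_tens_linear U V W (f g : vtens V W -> U) :
  linear f -> linear g -> (forall v w, f (tens v w) = g (tens v w)) -> f =1 g.
Proof.
move=> lf lg fg t; rewrite -(tlift_id t) /tlift !pair_big.
by rewrite (linear_sum_of lf) (linear_sum_of lg); apply: eq_bigr => i _; rewrite fg.
Qed.

Definition tens_map V V' W W' (f : V -> V') (g : W -> W') : vtens V W -> vtens V' W' :=
  tlift (fun v w => tens (f v) (g w)).
HB.instance Definition _ V V' W W' (f : V -> V') (g : W -> W') :=
  GRing.Linear.on (tens_map f g).

End TensorSpace.

(* The enveloping algebra A (x) A^op: (a (x) b) (a' (x) b') = a a' (x) b' b. *)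
Section Enveloping.
Variables (k : fieldType) (A : falgType k).

Definition env : Type := vtens A A.
HB.instance Definition _ := Vector.on env.

Definition env_mul (s t : env) : env :=
  tlift (fun a b => tlift (fun a' b' => tens (a * a') (b' * b)) t) s.
Definition env_one : env := tens 1 1.

Lemma env_mul_linl t : linear (env_mul^~ t).
Proof. exact: tlift_is_linear. Qed.

Lemma tens_inner_bilin (a b : A) :
  bilin (fun a' b' : A => tens (a * a') (b' * b) : vtens A A).
Proof.
split=> [b' | a'] c u v.
  by rewrite mulrDr -scalerAr tens_linl.
by rewrite mulrDl -scalerAl tens_linr.
Qed.

Lemma tlift_mul_linear t :
  bilin (fun a b : A => tlift (fun a' b' : A => tens (a * a') (b' * b)) t : vtens A A).
Proof.
split=> [b | a]; apply: tlift_linear_param => a' b' c u v.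
  by rewrite mulrDl -scalerAl tens_linl.
by rewrite mulrDr -scalerAr tens_linr.
Qed.

Lemma env_mul_tens (a b a' b' : A) :
  env_mul (tens a b) (tens a' b') = tens (a * a') (b' * b).
Proof.
by rewrite /env_mul tlift_tens ?tlift_tens //;
   [apply: tens_inner_bilin | apply: tlift_mul_linear].
Qed.

Lemma env_mul_linr s : linear (env_mul s).
Proof. by apply: tlift_linear_param => a b; apply: tlift_is_linear. Qed.

Lemma comp_linear (U V W : lmodType k) (f : V -> W) (g : U -> V) :
  linear f -> linear g -> linear (f \o g).
Proof. by move=> lf lg c u v /=; rewrite lg lf. Qed.

Lemma env_mulA : associative env_mul.
Proof.
move=> s t u; move: s; apply: eq_tens_linear => [||a b].
- exact: env_mul_linl.
- by apply: (comp_linear (f := env_mul^~ u)); apply: env_mul_linl.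
move: t; apply: eq_tens_linear => [||a' b'].
- by apply: (comp_linear (f := env_mul _)); [apply: env_mul_linr | apply: env_mul_linl].
- apply: (comp_linear (f := env_mul^~ u) (g := env_mul _)).
    exact: env_mul_linl.
  exact: env_mul_linr.
move: u; apply: eq_tens_linear => [||a'' b''].
- by apply: (comp_linear (f := env_mul _)); apply: env_mul_linr.
- exact: env_mul_linr.
by rewrite !env_mul_tens !mulrA.
Qed.

Lemma id_linear (V : vectType k) : linear (fun v : V => v).
Proof. by []. Qed.

Lemma env_mul1l : left_id env_one env_mul.
Proof.
apply: eq_tens_linear => [||a b]; [exact: env_mul_linr | exact: id_linear |].
by rewrite env_mul_tens mul1r mulr1.
Qed.

Lemma env_mul1r : right_id env_one env_mul.
Proof.
apply: eq_tens_linear => [||a b]; [exact: env_mul_linl | exact: id_linear |].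
by rewrite env_mul_tens mul1r mulr1.
Qed.

Lemma env_mulDl : left_distributive env_mul +%R.
Proof. by move=> s t u; have:= env_mul_linl u 1 s t; rewrite !scale1r. Qed.

Lemma env_mulDr : right_distributive env_mul +%R.
Proof. by move=> s t u; have:= env_mul_linr s 1 t u; rewrite !scale1r. Qed.

Lemma env_one_neq0 : env_one != 0.
Proof.
apply/eqP => one0; have/eqP[] := oner_neq0 A.
apply: etrans (coord_vbasis (memvf 1)) _; rewrite big1 // => i _.
case: (eqVneq (coord (vbasis fullv) i (1 : A)) 0) => [-> | nz]; first by rewrite scale0r.
have := congr1 (fun t : 'M_(_, _) => t i i) one0; rewrite !mxE.
by move/eqP; rewrite mulf_eq0 (negPf nz).
Qed.

HB.instance Definition _ := GRing.Zmodule_isNzRing.Build env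
  env_mulA env_mul1l env_mul1r env_mulDl env_mulDr env_one_neq0.

Lemma env_scaleAl (c : k) (s t : env) : c *: (s * t) = (c *: s) * t.
Proof. by have:= env_mul_linl t c s 0; rewrite /= addr0 [env_mul 0 t](mul0r t) addr0. Qed.

Lemma env_scaleAr (c : k) (s t : env) : c *: (s * t) = s * (c *: t).
Proof. by have:= env_mul_linr s c t 0; rewrite /= addr0 [env_mul s 0](mulr0 s) addr0. Qed.

HB.instance Definition _ := GRing.Lmodule_isLalgebra.Build k env env_scaleAl.
HB.instance Definition _ := GRing.Lalgebra_isAlgebra.Build k env env_scaleAr.
HB.instance Definition _ := Algebra_isFalgebra.Build k env.

Lemma env_mulE (a b a' b' : A) :
  (tens a b : env) * (tens a' b' : env) = tens (a * a') (b' * b).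
Proof. exact: env_mul_tens. Qed.

(* a (x) b |-> b (x) a, an anti-automorphism of A (x) A^op *)
Definition env_swap : env -> env := tlift (fun a b : A => tens b a).
HB.instance Definition _ := GRing.Linear.on env_swap.

Lemma env_swap_tens (a b : A) : env_swap (tens a b) = tens b a.
Proof. by rewrite /env_swap tlift_tens //; split=> ?; [apply: tens_linr | apply: tens_linl]. Qed.

Lemma env_swap1 : env_swap 1 = 1.
Proof. exact: env_swap_tens. Qed.

Lemma env_swapM s t : env_swap (s * t) = env_swap t * env_swap s.
Proof.
move: s; apply: eq_tens_linear => [||a b].
- apply: (comp_linear (f := env_swap) (g := env_mul^~ t)).
    exact: tlift_is_linear.
  exact: env_mul_linl.
- apply: (comp_linear (f := env_mul _) (g := env_swap)).
    exact: env_mul_linr.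
  exact: tlift_is_linear.
move: t; apply: eq_tens_linear => [||a' b'].
- apply: (comp_linear (f := env_swap) (g := env_mul _)).
    exact: tlift_is_linear.
  exact: env_mul_linr.
- apply: (comp_linear (f := env_mul^~ _) (g := env_swap)).
    exact: env_mul_linl.
  exact: tlift_is_linear.
by rewrite env_mulE !env_swap_tens env_mulE.
Qed.

End Enveloping.

Record lmodule (k : fieldType) (A : falgType k) := LModule {
  lmod_space :> vectType k;
  lact : A -> lmod_space -> lmod_space;
  lact_linl : forall v, linear (lact^~ v);
  lact_linr : forall a, linear (lact a);
  lact1 : forall v, lact 1 v = v;
  lactM : forall a b v, lact (a * b) v = lact a (lact b v)
}.

Record rmodule (k : fieldType) (A : falgType k) := RModule {
  rmod_space :> vectType k;
  ract : rmod_space -> A -> rmod_space;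
  ract_linl : forall a, linear (ract^~ a);
  ract_linr : forall v, linear (ract v);
  ract1 : forall v, ract v 1 = v;
  ractM : forall v a b, ract v (a * b) = ract (ract v a) b
}.

HB.instance Definition _ (k : fieldType) (A : falgType k) (M : lmodule A) (a : A) :=
  GRing.isLinear.Build k M M _ (lact a) (@lact_linr k A M a).

Section Modules.
Variables (k : fieldType) (A : falgType k).
Implicit Types M N P : lmodule A.

Definition lact_map M (a : A) : 'End(M) := linfun (lact a).

Lemma ract_map_subproof (N : rmodule A) (a : A) : linear (fun n : N => ract n a).
Proof. exact: ract_linl. Qed.
Definition ract_fun (N : rmodule A) (a : A) : N -> N := fun n => ract n a.
HB.instance Definition _ (N : rmodule A) (a : A) :=
  GRing.isLinear.Build k N N _ (@ract_fun N a) (@ract_map_subproof N a).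
Definition ract_map (N : rmodule A) (a : A) : 'End(N) := linfun (ract_fun a).

Section Comp.
Variables U V W : vectType k.
Definition precomp_fun (g : 'Hom(U, V)) (f : 'Hom(V, W)) : 'Hom(U, W) := (f \o g)%VF.
Lemma precomp_is_linear g : linear (precomp_fun g).
Proof. by move=> c f f'; rewrite /precomp_fun comp_lfunDl comp_lfunZl. Qed.
HB.instance Definition _ g :=
  GRing.isLinear.Build k 'Hom(V, W) 'Hom(U, W) _ (precomp_fun g) (precomp_is_linear g).
Definition precomp g : 'Hom('Hom(V, W), 'Hom(U, W)) := linfun (precomp_fun g).
Lemma precompE g f : precomp g f = (f \o g)%VF.
Proof. exact: lfunE. Qed.
Definition postcomp_fun (g : 'Hom(V, W)) (f : 'Hom(U, V)) : 'Hom(U, W) := (g \o f)%VF.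
Lemma postcomp_is_linear g : linear (postcomp_fun g).
Proof. by move=> c f f'; rewrite /postcomp_fun comp_lfunDr comp_lfunZr. Qed.
HB.instance Definition _ g :=
  GRing.isLinear.Build k 'Hom(U, V) 'Hom(U, W) _ (postcomp_fun g) (postcomp_is_linear g).
Definition postcomp g : 'Hom('Hom(U, V), 'Hom(U, W)) := linfun (postcomp_fun g).
Lemma postcompE g f : postcomp g f = (g \o f)%VF.
Proof. exact: lfunE. Qed.
End Comp.

Definition homA M N : {vspace 'Hom(M, N)} :=
  (\bigcap_(i < \dim {: A})
     lker (precomp N (lact_map M (vbasis {: A})`_i)
           - postcomp M (lact_map N (vbasis {: A})`_i)))%VS.

Lemma homAP M N (f : 'Hom(M, N)) :
  reflect (forall a v, f (lact a v) = lact a (f v)) (f \in homA M N).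
Proof.
apply: (iffP idP) => [fA a v | fA].
  rewrite (coord_vbasis (memvf a)) (linear_sum_of (lact_linl v)).
  rewrite (linear_sum_of (lact_linl (f v))) linear_sum; apply: eq_bigr => i _.
  rewrite linearZ; congr (_ *: _).
  have: f \in lker (precomp N (lact_map M (vbasis {: A})`_i)
           - postcomp M (lact_map N (vbasis {: A})`_i)).
    by move: fA; rewrite !memvE => /subv_bigcapP/(_ i isT).
  move/eqlfunP; rewrite precompE postcompE => /lfunP/(_ v).
  by rewrite !comp_lfunE !lfunE.
rewrite memvE; apply/subv_bigcapP => i _; rewrite -memvE; apply/eqlfunP.
by rewrite precompE postcompE; apply/lfunP => v; rewrite !comp_lfunE !lfunE /= fA.
Qed.

Arguments homAP {M N f}.

Definition lsubmodule M (U : {vspace M}) := forall a v, v \in U -> lact a v \in U.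
Definition rsubmodule (N : rmodule A) (U : {vspace N}) :=
  forall a v, v \in U -> ract v a \in U.

Section Sub.
Variables (M : lmodule A) (U : {vspace M}) (subU : lsubmodule U).

Definition sub_act (a : A) (u : subvs_of U) : subvs_of U := vsproj U (lact a (vsval u)).
Lemma sub_actE a u : vsval (sub_act a u) = lact a (vsval u).
Proof. by rewrite /sub_act vsprojK // subU ?subvsP. Qed.

Lemma sub_act_linl u : linear (sub_act^~ u).
Proof. by move=> c a b; rewrite /sub_act lact_linl linearP. Qed.
Lemma sub_act_linr a : linear (sub_act a).
Proof. by move=> c u v; rewrite /sub_act !linearP. Qed.
Lemma sub_act1 u : sub_act 1 u = u.
Proof. by apply: subvs_inj; rewrite sub_actE lact1. Qed.
Lemma sub_actM a b u : sub_act (a * b) u = sub_act a (sub_act b u).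
Proof. by apply: subvs_inj; rewrite !sub_actE lactM. Qed.

Definition sub_mod : lmodule A :=
  LModule sub_act_linl sub_act_linr sub_act1 sub_actM.
End Sub.

Section Quo.
Variables (N : rmodule A) (U : {vspace N}) (subU : rsubmodule U).

Definition quo_act (q : vquot U) (a : A) : vquot U := vquot_proj U (ract (vsval q) a).

Lemma quo_actE v a : quo_act (vquot_proj U v) a = vquot_proj U (ract v a).
Proof.
apply/eqP; rewrite -subr_eq0 /quo_act -linearB vquot_proj_eq0 -opprB rpredN.
have -> : ract v a - ract (vsval (vquot_proj U v)) a
        = ract (v - vsval (vquot_proj U v)) a :> N.
  by rewrite -[LHS](linearB (@ract_fun N a)).
by rewrite subU ?vquot_projK.
Qed.

Lemma quo_act_linl a : linear (quo_act^~ a).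
Proof. by move=> c u v; rewrite /quo_act linearP ract_linl linearP. Qed.
Lemma quo_act_linr q : linear (quo_act q).
Proof. by move=> c a b; rewrite /quo_act ract_linr linearP. Qed.
Lemma quo_act1 q : quo_act q 1 = q.
Proof. by rewrite /quo_act ract1 vsvalQK. Qed.
Lemma quo_actM q a b : quo_act q (a * b) = quo_act (quo_act q a) b.
Proof. by rewrite [quo_act q a]/quo_act quo_actE /quo_act ractM. Qed.

Definition quo_rmod : rmodule A :=
  RModule quo_act_linl quo_act_linr quo_act1 quo_actM.
End Quo.

(* D N = Hom_k(N, k) with (a f)(n) = f(n a) *)
Section Dual.
Variable N : rmodule A.
Definition dual_act (a : A) (f : 'Hom(N, k^o)) : 'Hom(N, k^o) := (f \o ract_map N a)%VF.
Lemma dual_actE a f n : dual_act a f n = f (ract n a).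
Proof. by rewrite comp_lfunE lfunE. Qed.
Lemma dual_act_linl f : linear (dual_act^~ f).
Proof.
move=> c a b; apply/lfunP => n.
by rewrite dual_actE ract_linr linearP add_lfunE scale_lfunE !dual_actE.
Qed.
Lemma dual_act_linr a : linear (dual_act a).
Proof. by move=> c f g; rewrite /dual_act comp_lfunDl comp_lfunZl. Qed.
Lemma dual_act1 f : dual_act 1 f = f.
Proof. by apply/lfunP => n; rewrite dual_actE ract1. Qed.
Lemma dual_actM a b f : dual_act (a * b) f = dual_act a (dual_act b f).
Proof. by apply/lfunP => n; rewrite !dual_actE ractM. Qed.
Definition dual_mod : lmodule A :=
  LModule dual_act_linl dual_act_linr dual_act1 dual_actM.
End Dual.

Definition reg_act (a v : A) : A := a * v.
Lemma reg_act_linl v : linear (reg_act^~ v).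
Proof. by move=> c a b; rewrite /reg_act mulrDl scalerAl. Qed.
Lemma reg_act_linr a : linear (reg_act a).
Proof. by move=> c u v; rewrite /reg_act mulrDr scalerAr. Qed.
Definition reg_mod : lmodule A :=
  LModule reg_act_linl reg_act_linr (@mul1r A) (fun a b v => esym (mulrA a b v)).

(* The right module P^* = Hom_A(P, A): (f a)(p) = f(p) a. *)
Section Star.
Variable P : lmodule A.
Definition star_act (f : subvs_of (homA P reg_mod)) (a : A) :
    subvs_of (homA P reg_mod) :=
  vsproj (homA P reg_mod) (amulr a \o (vsval f : 'Hom(P, A)))%VF.

Lemma star_actE f a p : vsval (star_act f a) p = vsval f p * a.
Proof.
rewrite /star_act vsprojK; first by rewrite comp_lfunE lfunE.
apply/homAP => b v; rewrite !comp_lfunE !lfunE /=.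
by rewrite (homAP (subvsP f)) /= /reg_act mulrA.
Qed.
Lemma starP (f g : subvs_of (homA P reg_mod)) : (forall p, vsval f p = vsval g p) -> f = g.
Proof. by move=> fg; apply: subvs_inj; apply/lfunP => p; apply: fg. Qed.
Lemma star_linE c (f g : subvs_of (homA P reg_mod)) p :
  vsval (c *: f + g) p = c *: (vsval f p : A) + vsval g p.
Proof. by rewrite (linearP vsval) add_lfunE scale_lfunE. Qed.
Lemma star_act_linl a : linear (star_act^~ a).
Proof.
by move=> c f g; apply: starP => p; rewrite star_linE !star_actE star_linE mulrDl scalerAl.
Qed.
Lemma star_act_linr f : linear (star_act f).
Proof.
by move=> c a b; apply: starP => p; rewrite star_linE !star_actE mulrDr scalerAr.
Qed.
Lemma star_act1 f : star_act f 1 = f.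
Proof. by apply: starP => p; rewrite star_actE mulr1. Qed.
Lemma star_actM f a b : star_act f (a * b) = star_act (star_act f a) b.
Proof. by apply: starP => p; rewrite !star_actE mulrA. Qed.
Definition star : rmodule A := RModule star_act_linl star_act_linr star_act1 star_actM.
End Star.
End Modules.
Arguments homAP {k A M N f}.

Section ProjectiveCovers.
Variables (k : fieldType) (A : falgType k).
Implicit Types M N P : lmodule A.

Definition projective P : Prop :=
  forall M N (g : 'Hom(M, N)) (f : 'Hom(P, N)),
    g \in homA M N -> limg g = fullv -> f \in homA P N ->
  exists2 h : 'Hom(P, M), h \in homA P M & (g \o h)%VF = f.

Definition superfluous M (K : {vspace M}) : Prop :=
  forall U : {vspace M}, lsubmodule U -> (U + K)%VS = fullv -> U = fullv.

Record proj_cover M := ProjCover {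
  pc_mod :> lmodule A;
  pc_map : 'Hom(pc_mod, M);
  pc_hom : pc_map \in homA pc_mod M;
  pc_surj : limg pc_map = fullv;
  pc_proj : projective pc_mod;
  pc_min : superfluous (lker pc_map)
}.

Lemma homA_comp M N P (g : 'Hom(N, P)) (f : 'Hom(M, N)) :
  g \in homA N P -> f \in homA M N -> (g \o f)%VF \in homA M P.
Proof.
by move=> /homAP gA /homAP fA; apply/homAP => a v; rewrite !comp_lfunE fA gA.
Qed.

Definition sub_incl M (U : {vspace M}) (subU : lsubmodule U) : 'Hom(sub_mod subU, M) :=
  linfun (vsval : subvs_of U -> M).
Lemma sub_inclE M (U : {vspace M}) (subU : lsubmodule U) (u : sub_mod subU) :
  sub_incl subU u = vsval (u : subvs_of U).
Proof. exact: lfunE. Qed.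
Lemma sub_incl_hom M (U : {vspace M}) (subU : lsubmodule U) :
  sub_incl subU \in homA (sub_mod subU) M.
Proof. by apply/homAP => a u; rewrite !sub_inclE sub_actE. Qed.

Lemma ker_lsubmodule M N (f : 'Hom(M, N)) : f \in homA M N -> lsubmodule (lker f).
Proof.
by move=> /homAP fA a v; rewrite !memv_ker fA => /eqP->; rewrite linear0.
Qed.

Definition ker_mod M N (f : 'Hom(M, N)) (fA : f \in homA M N) : lmodule A :=
  sub_mod (ker_lsubmodule fA).

Lemma linfunE (U V : vectType k) (f : U -> V) : linear f -> linfun f =1 f.
Proof.
by move=> lf x; rewrite -[f]/(HB.pack_for {linear U -> V} f
  (GRing.isLinear.Build k U V _ f lf) : U -> V) lfunE.
Qed.

Lemma lact0l M (v : M) : lact (0 : A) v = 0.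
Proof. by have := linear0 (HB.pack_for {linear A -> M} (fun a => lact a v)
  (GRing.isLinear.Build k A M _ (fun a => lact a v) (lact_linl v))). Qed.

Section Free.
Variable d : nat.
Definition free_act (a : A) (v : {ffun 'I_d -> A}) : {ffun 'I_d -> A} :=
  [ffun i => a * v i].
Lemma free_act_linl v : linear (free_act^~ v).
Proof. by move=> c a b; apply/ffunP => i; rewrite !ffunE mulrDl scalerAl. Qed.
Lemma free_act_linr a : linear (free_act a).
Proof. by move=> c u v; apply/ffunP => i; rewrite !ffunE mulrDr scalerAr. Qed.
Lemma free_act1 v : free_act 1 v = v.
Proof. by apply/ffunP => i; rewrite !ffunE mul1r. Qed.
Lemma free_actM a b v : free_act (a * b) v = free_act a (free_act b v).
Proof. by apply/ffunP => i; rewrite !ffunE mulrA. Qed.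
Definition free_mod : lmodule A :=
  LModule free_act_linl free_act_linr free_act1 free_actM.

Definition free_hom M (m : 'I_d -> M) : 'Hom(free_mod, M) :=
  linfun (fun v : {ffun 'I_d -> A} => \sum_i lact (v i) (m i)).
Lemma free_homE M (m : 'I_d -> M) (v : free_mod) :
  free_hom m v = \sum_i lact ((v : {ffun _ -> _}) i) (m i).
Proof.
rewrite linfunE // => c {}v w; rewrite scaler_sumr -big_split.
by apply: eq_bigr => i _; rewrite !ffunE lact_linl.
Qed.
Lemma free_homA M (m : 'I_d -> M) : free_hom m \in homA free_mod M.
Proof.
apply/homAP => a v; rewrite !free_homE linear_sum; apply: eq_bigr => i _.
by rewrite ffunE lactM.
Qed.
Definition free_gen (i : 'I_d) : free_mod := [ffun j => (i == j)%:R] : {ffun 'I_d -> A}.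
Lemma free_hom_gen M (m : 'I_d -> M) i : free_hom m (free_gen i) = m i.
Proof.
rewrite free_homE (bigD1 i) //= ffunE eqxx lact1 big1 ?addr0 // => j ne.
by rewrite ffunE eq_sym (negPf ne) lact0l.
Qed.
Lemma free_eq M (f g : 'Hom(free_mod, M)) :
    f \in homA free_mod M -> g \in homA free_mod M ->
  (forall i, f (free_gen i) = g (free_gen i)) -> f = g.
Proof.
move=> /homAP fA /homAP gA fg; apply/lfunP => v.
have -> : v = \sum_i lact ((v : {ffun _ -> _}) i) (free_gen i).
  apply/ffunP => j; rewrite sum_ffunE (bigD1 j) //= !ffunE eqxx mulr1 big1 ?addr0 //.
  by move=> i /negPf ne; rewrite !ffunE ne mulr0.
rewrite !linear_sum; apply: eq_bigr => i _.
by apply: etrans (fA _ _) _; rewrite fg; apply: esym (gA _ _).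
Qed.
Lemma free_projective : projective free_mod.
Proof.
move=> M N g f gA gsurj fA; pose m i := g^-1%VF (f (free_gen i)).
exists (free_hom m); first exact: free_homA.
apply: free_eq => //; first by apply: homA_comp => //; apply: free_homA.
by move=> i; rewrite comp_lfunE free_hom_gen limg_lfunVK ?gsurj ?memvf.
Qed.
End Free.

Lemma free_surj M : limg (free_hom (fun i : 'I_(\dim {: M}) => (vbasis {: M})`_i)) = fullv.
Proof.
apply/vspaceP => v; rewrite memvf (coord_vbasis (memvf v)).
apply: rpred_sum => i _; rewrite rpredZ //.
rewrite -(free_hom_gen (fun i : 'I_(\dim {: M}) => (vbasis {: M})`_i) i).
exact: memv_img (memvf _).
Qed.

Lemma limg_sub M N (U : {vspace M}) (subU : lsubmodule U) (f : 'Hom(M, N)) :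
  limg (f \o sub_incl subU) = (f @: U)%VS.
Proof.
apply/vspaceP => w; apply/memv_imgP/memv_imgP => [[u _ ->] | [u Uu ->]].
  by exists (vsval (u : subvs_of U)); rewrite ?subvsP // comp_lfunE sub_inclE.
by exists (vsproj U u); rewrite ?memvf // comp_lfunE sub_inclE vsprojK.
Qed.

Lemma surjP (U V : vectType k) (f : 'Hom(U, V)) :
  limg f = fullv <-> forall w, exists v, f v = w.
Proof.
split=> [sf w | sf].
  by have := memvf w; rewrite -sf => /memv_imgP[v _ ->]; exists v.
by apply/vspaceP => w; rewrite memvf; have [v <-] := sf w; rewrite memv_img ?memvf.
Qed.

Lemma proj_cover_exists M : inhabited (proj_cover M).
Proof.
have [P [p [pA psurj Pproj]]] : exists P (p : 'Hom(P, M)),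
    [/\ p \in homA P M, limg p = fullv & projective P].
  exists (free_mod (\dim {: M})), (free_hom (fun i : 'I_(\dim {: M}) => (vbasis {: M})`_i)).
  split; last exact: free_projective.
    exact: free_homA.
  exact: free_surj.
pose ok d := `[< exists U : {vspace P},
  [/\ lsubmodule U, (U + lker p)%VS = fullv & \dim U = d] >].
have ex_ok : exists d, ok d.
  exists (\dim {: P}); apply/asboolP; exists fullv; split=> //.
    by move=> a v _; apply: memvf.
  by apply/eqP; rewrite eqEsubv subvf addvSl.
case: (ex_minnP ex_ok) => _ /asboolP[U [subU Ufull <-]] Umin {ex_ok}.
pose S := sub_mod subU; pose q : 'Hom(S, M) := (p \o sub_incl subU)%VF.
have qA : q \in homA S M by apply: homA_comp => //; apply: sub_incl_hom.
have qsurj : limg q = fullv.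
  rewrite limg_sub -psurj -Ufull limgD.
  suff -> : (p @: lker p = 0)%VS by rewrite addv0.
  by apply/eqP; rewrite -lkerE.
have qmin : superfluous (lker q).
  move=> W subW Wfull.
  pose W' := (sub_incl subU @: W)%VS.
  have W'U : (W' <= U)%VS.
    by apply/subvP => _ /memv_imgP[w _ ->]; rewrite sub_inclE subvsP.
  have: (\dim U <= \dim W')%N.
    apply: Umin; apply/asboolP; exists W'; split=> //.
      move=> a _ /memv_imgP[w Ww ->].
      by rewrite -(homAP (sub_incl_hom subU)) memv_img // subW.
    apply/eqP; rewrite eqEsubv subvf -Ufull subv_add addvSr andbT.
    apply/subvP => u Uu.
    have := memvf (vsproj U u : S); rewrite -Wfull => /memv_addP[w Ww [v qv uE]].
    have -> : u = sub_incl subU w + sub_incl subU v.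
      by rewrite -linearD -uE /= sub_inclE vsprojK.
    rewrite memv_add ?memv_img // memv_ker -comp_lfunE -/q.
    by rewrite -memv_ker.
  move=> dimU; apply/eqP; rewrite eqEdim subvf dimvf.
  have := limg_ker_dim (sub_incl subU) W; rewrite -/W' => <-.
  by apply: leq_trans (leq_addl _ _).
have [h hA qh] := Pproj _ _ _ _ qA qsurj pA.
pose s : 'End(S) := (h \o sub_incl subU)%VF.
have sA : s \in homA S S by apply: homA_comp => //; apply: sub_incl_hom.
have qs : (q \o s)%VF = q by rewrite /s comp_lfunA qh.
have ssurj : limg s = fullv.
  apply: qmin.
    by move=> a _ /memv_imgP[v _ ->]; rewrite -(homAP sA) memv_img ?memvf.
  apply/vspaceP => v; rewrite memvf; apply/memv_addP.
  exists (s v); rewrite ?memv_img ?memvf //; exists (v - s v); last by rewrite addrC subrK.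
  by rewrite memv_ker linearB /= -[q (s v)]comp_lfunE qs subrr.
have sker : lker s == 0%VS.
  have := limg_ker_dim s fullv; rewrite ssurj capfv => /eqP.
  by rewrite -[X in _ == X]add0n eqn_add2r dimv_eq0.
have siA : s^-1%VF \in homA S S.
  apply/homAP => a v; apply: (lker0P sker).
  by rewrite (homAP sA) !lker0_lfunVK.
pose r : 'Hom(P, S) := (s^-1 \o h)%VF.
have rA : r \in homA P S by apply: homA_comp.
have rK : (r \o sub_incl subU)%VF = \1%VF.
  by rewrite /r -comp_lfunA -/s lker0_compVf.
have Sproj : projective S.
  move=> M' N' g f gA gsurj fA.
  have [h' h'A gh'] := Pproj _ _ _ _ gA gsurj (homA_comp fA rA).
  exists (h' \o sub_incl subU)%VF; first by apply: homA_comp => //; apply: sub_incl_hom.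
  by rewrite comp_lfunA gh' -comp_lfunA rK comp_lfun1r.
exact: inhabits (ProjCover qA qsurj Sproj qmin).
Qed.

(* Projective covers are unique up to isomorphism, so the choice is harmless. *)
Definition pcover M : proj_cover M := inhabited_witness (proj_cover_exists M).

End ProjectiveCovers.

Section HomologicalAlgebra.
Variables (k : fieldType) (A : falgType k).
Implicit Types (M X : lmodule A) (N : rmodule A).

(* Syzygies and the minimal projective resolution
   ... -> res M 1 -> res M 0 -> M, with res M n the projective cover of the
   n-th syzygy and res_d M n : res M n.+1 -> syzygy n.+1 M -> res M n. *)
Definition syzygy1 M : lmodule A := ker_mod (pc_hom (pcover M)).
Definition syzygy n M : lmodule A := iter n syzygy1 M.

Definition res M n : lmodule A := pcover (syzygy n M).

Definition cover_d M : 'Hom(pcover (syzygy1 M), pcover M) :=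
  (sub_incl (ker_lsubmodule (pc_hom (pcover M))) \o pc_map (pcover (syzygy1 M)))%VF.

Lemma cover_d_hom M : cover_d M \in homA (pcover (syzygy1 M)) (pcover M).
Proof. by apply: homA_comp (pc_hom _); apply: sub_incl_hom. Qed.

Definition res_d M n : 'Hom(res M n.+1, res M n) := cover_d (syzygy n M).

Section StarMap.
Variables (P Q : lmodule A) (g : 'Hom(P, Q)).
Definition star_map_fun (f : star Q) : star P :=
  vsproj (homA P (reg_mod A))
    (precomp (reg_mod A) g (vsval (f : subvs_of (homA Q (reg_mod A))))).
Lemma star_map_is_linear : linear star_map_fun.
Proof. by move=> c f f'; rewrite /star_map_fun !linearP. Qed.
HB.instance Definition _ :=
  GRing.isLinear.Build k (star Q) (star P) _ star_map_fun star_map_is_linear.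
Definition star_map : 'Hom(star Q, star P) := linfun star_map_fun.

Hypothesis gA : g \in homA P Q.

Lemma star_mapE f p : vsval (star_map f : subvs_of _) p = vsval (f : subvs_of _) (g p).
Proof.
rewrite lfunE /= /star_map_fun vsprojK precompE ?comp_lfunE //.
exact: homA_comp (subvsP f) gA.
Qed.

Lemma star_map_rsubmodule : rsubmodule (limg star_map : {vspace star P}).
Proof.
move=> a _ /memv_imgP[f _ ->].
suff -> : ract (star_map f) a = star_map (ract f a) by rewrite memv_img ?memvf.
apply: starP => p; rewrite star_mapE.
by apply: etrans (star_actE _ _ _) _; rewrite star_mapE; apply: esym (star_actE _ _ _).
Qed.
End StarMap.

(* Tr M = coker (Hom(P_0, A) -> Hom(P_1, A)) for the minimal presentation P_1 -> P_0 -> M,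
   where P_0 and P_1 cover M and its first syzygy. *)
Definition Tr M : rmodule A := quo_rmod (star_map_rsubmodule (cover_d_hom M)).
Definition tau M : lmodule A := dual_mod (Tr M).
Definition tau_ n M : lmodule A := tau (syzygy n.-1 M).

Lemma cover_d_exact M : limg (cover_d M) = lker (pc_map (pcover M)).
Proof.
rewrite /cover_d limg_comp pc_surj; apply/vspaceP => v.
apply/memv_imgP/idP => [[u _ ->] | pv].
  by rewrite sub_inclE subvsP.
by exists (vsproj (lker (pc_map (pcover M))) v); rewrite ?memvf // sub_inclE vsprojK.
Qed.

Lemma res_exact M n : limg (res_d M n.+1) = lker (res_d M n).
Proof.
rewrite /res_d cover_d_exact; apply/vspaceP => v.
rewrite !memv_ker comp_lfunE sub_inclE.
by apply/eqP/eqP => [-> | v0]; [rewrite (linear0 vsval) | apply: subvs_inj].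
Qed.

Lemma res_dd M n : (res_d M n \o res_d M n.+1 = 0)%VF.
Proof.
apply/lfunP => v; rewrite zero_lfunE; apply/eqP.
apply: etrans (congr1 (eq_op^~ 0) (comp_lfunE (res_d M n) (res_d M n.+1) v)) _.
by rewrite -memv_ker -res_exact memv_img ?memvf.
Qed.

Lemma res_proj M n : projective (res M n).
Proof. exact: pc_proj. Qed.

(* Ext and Tor may be computed from any projective resolution of M; the minimal
   one is used. Ext^n_A(M, X) is the cohomology of Hom_A(res M, X). *)
Definition Ext_cocycle M X n : {vspace 'Hom(res M n, X)} :=
  (homA (res M n) X :&: lker (precomp X (res_d M n)))%VS.
Definition Ext_cobound M X n : {vspace 'Hom(res M n, X)} :=
  match n return {vspace 'Hom(res M n, X)} with
  | 0 => 0%VS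
  | n'.+1 => (precomp X (res_d M n') @: homA (res M n') X)%VS
  end.
Lemma Ext_cobound_sub M X n : (Ext_cobound M X n <= Ext_cocycle M X n)%VS.
Proof.
case: n => [|n] /=; first exact: sub0v.
apply/subvP => _ /memv_imgP[f fA ->]; rewrite precompE memv_cap; apply/andP; split.
  exact: homA_comp fA (cover_d_hom _).
by rewrite memv_ker precompE -comp_lfunA res_dd comp_lfun0r.
Qed.

Definition Ext n M X : vectType k := subquot (Ext_cocycle M X n) (Ext_cobound M X n).

(* N (x)_A M, the quotient of N (x)_k M by all n a (x) m - n (x) a m; it is
   enough to let n, a, m run through bases. *)
Definition tensA_rel N M : {vspace vtens N M} :=
  (\sum_(i < \dim {: N}) \sum_(j < \dim {: A}) \sum_(l < \dim {: M})
     <[ tens (ract (vbasis {: N})`_i (vbasis {: A})`_j) (vbasis {: M})`_l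
        - tens (vbasis {: N})`_i (lact (vbasis {: A})`_j (vbasis {: M})`_l) ]>)%VS.
Definition tensA N M : vectType k := vquot (tensA_rel N M).
Definition tensA_map N M M' (f : 'Hom(M, M')) : 'Hom(tensA N M, tensA N M') :=
  linfun (vquot_proj (tensA_rel N M') \o (tens_map (idfun : N -> N) f \o vsval)).

Lemma tensA_relP N M (n : N) (a : A) (m : M) :
  tens (ract n a) m - tens n (lact a m) \in tensA_rel N M.
Proof.
have lin1 (a' : A) (m' : M) : linear (fun n : N => tens (ract n a') m' - tens n (lact a' m')).
  by move=> c u v; rewrite ract_linl !tens_linl scalerBr addrACA -opprD.
have lin2 (n' : N) (m' : M) : linear (fun a' : A => tens (ract n' a') m' - tens n' (lact a' m')).
  move=> c u v; rewrite ract_linr lact_linl tens_linl tens_linr.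
  by rewrite scalerBr addrACA -opprD.
have lin3 (n' : N) (a' : A) : linear (fun m' : M => tens (ract n' a') m' - tens n' (lact a' m')).
  by move=> c u v; rewrite lact_linr !tens_linr scalerBr addrACA -opprD.
rewrite (coord_vbasis (memvf n)) (linear_sum_of (lin1 _ _)).
apply: rpred_sum => i _; apply: rpredZ.
rewrite (coord_vbasis (memvf a)) (linear_sum_of (lin2 _ _)).
apply: rpred_sum => j _; apply: rpredZ.
rewrite (coord_vbasis (memvf m)) (linear_sum_of (lin3 _ _)).
apply: rpred_sum => l _; apply: rpredZ.
rewrite memvE /tensA_rel (sumv_sup i) // (sumv_sup j) // (sumv_sup l) //.
Qed.

(* The homology of N (x)_A res M *)
Definition Tor_cycle N M n : {vspace tensA N (res M n)} :=
  match n return {vspace tensA N (res M n)} with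
  | 0 => fullv
  | n'.+1 => lker (tensA_map N (res_d M n'))
  end.
Definition Tor_bound N M n : {vspace tensA N (res M n)} :=
  limg (tensA_map N (res_d M n)).
Definition Tor n N M : vectType k := subquot (Tor_cycle N M n) (Tor_bound N M n).

End HomologicalAlgebra.

Notation bimodule A := (lmodule (env A)).

Section Bimodules.
Variables (k : fieldType) (A : falgType k).
Implicit Types X : bimodule A.

(* A as a bimodule: (a (x) b) v = a v b *)
Definition self_act (t : env A) (v : A) : A := tlift (fun a b : A => a * v * b) t.

Lemma self_act_linr t : linear (self_act t).
Proof.
by apply: tlift_linear_param => a b c u v; rewrite mulrDr mulrDl -scalerAr -scalerAl.
Qed.
Lemma self_act_linl v : linear (self_act^~ v).
Proof. exact: tlift_is_linear. Qed.
Lemma self_act_tens (a b v : A) : self_act (tens a b) v = a * v * b.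
Proof.
rewrite /self_act tlift_tens //; split=> [b' | a'] c x y.
  by rewrite !mulrDl -!scalerAl.
by rewrite mulrDr -scalerAr.
Qed.
Lemma self_act1 v : self_act 1 v = v.
Proof. by rewrite self_act_tens mul1r mulr1. Qed.
Lemma self_actM s t v : self_act (s * t) v = self_act s (self_act t v).
Proof.
move: s; apply: eq_tens_linear => [||a b].
- apply: (comp_linear (f := self_act^~ v) (g := (@env_mul k A)^~ t)).
    exact: self_act_linl.
  exact: env_mul_linl.
- exact: self_act_linl.
move: t; apply: eq_tens_linear => [||a' b'].
- apply: (comp_linear (f := self_act^~ v) (g := @env_mul k A _)).
    exact: self_act_linl.
  exact: env_mul_linr.
- apply: (comp_linear (f := self_act _) (g := self_act^~ v)).
    exact: self_act_linr.
  exact: self_act_linl.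
by rewrite env_mulE !self_act_tens !mulrA.
Qed.
Definition self_bimod : bimodule A :=
  LModule self_act_linl self_act_linr self_act1 self_actM.

(* A bimodule as a right module over A (x) A^op: v (a (x) b) = b v a *)
Section RightOf.
Variable X : bimodule A.
Definition swap_act (v : X) (t : env A) : X := lact (env_swap t) v.
Lemma swap_act_linl t : linear (swap_act^~ t).
Proof. exact: lact_linr. Qed.
Lemma swap_act_linr v : linear (swap_act v).
Proof. by move=> c s t; rewrite /swap_act linearP lact_linl. Qed.
Lemma swap_act1 v : swap_act v 1 = v.
Proof. by rewrite /swap_act env_swap1 lact1. Qed.
Lemma swap_actM v s t : swap_act v (s * t) = swap_act (swap_act v s) t.
Proof. by rewrite /swap_act env_swapM lactM. Qed.
Definition bimod_right : rmodule (env A) :=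
  RModule swap_act_linl swap_act_linr swap_act1 swap_actM.
End RightOf.

(* D X, with (a f b)(v) = f(b v a) *)
Definition bimod_dual X : bimodule A := dual_mod (bimod_right X).

Lemma bimod_dualE X (a b : A) (f : bimod_dual X) (v : X) :
  (lact (tens a b : env A) f : 'Hom(X, k^o)) v
    = (f : 'Hom(X, k^o)) (lact (tens b a : env A) v).
Proof. by rewrite [LHS](@dual_actE k (env A) (bimod_right X)) /= /swap_act env_swap_tens. Qed.

Definition HHcoh n X : vectType k := Ext n self_bimod X.
Definition HHhom n X : vectType k := Tor n (bimod_right X) self_bimod.

Definition tauHHcoh n X : vectType k :=
  'Hom(subvs_of (homA X (tau_ n self_bimod)), k^o).
Definition tauHHhom n X : vectType k :=
  subvs_of (homA (bimod_dual X) (tau_ n self_bimod)).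

End Bimodules.

Record quiver := Quiver {
  vertex : finType;
  arrow : finType;
  source : arrow -> vertex;
  target : arrow -> vertex
}.

(* A path is a starting vertex with the list of its arrows in order of travel;
   the trivial path at x is (x, [::]). *)
Section Paths.
Variable Q : quiver.
Implicit Types (x y : vertex Q) (a : arrow Q) (s : seq (arrow Q)).

Fixpoint walk x s : bool :=
  if s is a :: s' then (source a == x) && walk (target a) s' else true.
Fixpoint walk_end x s : vertex Q :=
  if s is a :: s' then walk_end (target a) s' else x.

Record qpath := QPath {
  qpath_val :> vertex Q * seq (arrow Q);
  qpath_walk : walk qpath_val.1 qpath_val.2
}.
HB.instance Definition _ := [isSub for qpath_val].
HB.instance Definition _ := [Choice of qpath by <:].

Definition path_source (p : qpath) : vertex Q := (val p).1.
Definition path_target (p : qpath) : vertex Q := walk_end (val p).1 (val p).2.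

Lemma walk_cat x s t : walk x (s ++ t) = walk x s && walk (walk_end x s) t.
Proof. by elim: s x => //= a s IH x; rewrite IH andbA. Qed.
Lemma walk_end_cat x s t : walk_end x (s ++ t) = walk_end (walk_end x s) t.
Proof. by elim: s x => //=. Qed.

Lemma walk_arrow a : walk (source a, [:: a]).1 (source a, [:: a]).2.
Proof. by rewrite /= eqxx. Qed.

Definition path_id x : qpath := @QPath (x, [::]) isT.
Definition path_arrow a : qpath :=
  @QPath (source a, [:: a]) (walk_arrow a).

(* Paths are composed from right to left: p q means first q, then p. *)
Definition path_comp (p q : qpath) : option qpath :=
  if path_target q == path_source p then
    insub (path_source q, (val q).2 ++ (val p).2)
  else None.

Lemma path_compP p q :
  (exists r : qpath, [/\ path_target q = path_source p, path_comp p q = Some r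
     & val r = (path_source q, (val q).2 ++ (val p).2)])
  \/ (path_target q <> path_source p /\ path_comp p q = None).
Proof.
rewrite /path_comp; case: eqP => [qp | ne]; last by right.
left; case: insubP => [r _ rE | /negP[]]; first by exists r.
by rewrite /= walk_cat (valP q) -/(path_target q) qp (valP p).
Qed.

Lemma path_compA p q r :
  obind (path_comp p) (path_comp q r) = obind (path_comp^~ r) (path_comp p q).
Proof.
case: (path_compP q r) => [[u [rq -> uE]] | [rq ->]] /=;
  case: (path_compP p q) => [[v [qp -> vE]] | [qp ->]] //=.
- have tu : path_target u = path_target q.
    by rewrite /path_target uE /= walk_end_cat -/(path_target r) rq.
  have sv : path_source v = path_source q by rewrite /path_source vE.
  case: (path_compP p u) => [[w [up -> wE]] | [up _]]; last by rewrite tu in up.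
  case: (path_compP v r) => [[w' [rv -> wE']] | [rv _]]; last by rewrite sv in rv.
  congr Some; apply: val_inj; rewrite wE wE' vE uE /=.
  by rewrite /path_source uE catA.
- have tu : path_target u = path_target q.
    by rewrite /path_target uE /= walk_end_cat -/(path_target r) rq.
  case: (path_compP p u) => [[w [up _ _]] | [_ ->]] //.
  by case: qp; rewrite -up tu.
have sv : path_source v = path_source q by rewrite /path_source vE.
case: (path_compP v r) => [[w [rv _ _]] | [_ ->]] //.
by case: rq; rewrite rv sv.
Qed.

Lemma path_comp_idl x p :
  path_comp (path_id x) p = if path_target p == x then Some p else None.
Proof.
case: (path_compP (path_id x) p) => [[r [px -> rE]] | [px ->]].
  rewrite px eqxx; congr Some; apply: val_inj; rewrite rE /= cats0.
  by case: p {px rE} => [[]].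
by case: eqP => // /px.
Qed.

Lemma path_comp_idr x p :
  path_comp p (path_id x) = if path_source p == x then Some p else None.
Proof.
case: (path_compP p (path_id x)) => [[r [px -> rE]] | [px ->]].
  rewrite -px eqxx; congr Some; apply: val_inj; rewrite rE /=.
  rewrite /path_source /= [x]px.
  by case: p {px rE} => [[]].
by case: eqP => // /esym /px.
Qed.

Lemma path_comp_eq_id x p q :
  path_comp p q = Some (path_id x) -> p = path_id x /\ q = path_id x.
Proof.
case: (path_compP p q) => [[r [qp -> rE]] [rx]| [_ ->]] //.
move: rE; rewrite {}rx; case: p q qp => [[xp sp] wp] [[xq sq] wq] /=.
rewrite /path_target /path_source /= => qp [xE].
case: sq wq qp => // wq; case: sp wp => // wp /= qp _.
by split; apply: val_inj; rewrite /= -?qp xE.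
Qed.

End Paths.

Section PathAlgebra.
Variables (k : fieldType) (Q : quiver).

Definition path_alg : Type := {malg k[qpath Q]}.
HB.instance Definition _ := GRing.Lmodule.on path_alg.

Fact path_key : unit. Proof. by []. Qed.

Definition path_elt : qpath Q -> path_alg := locked_with path_key (fun p => << p >>).
Lemma path_eltE p : path_elt p = << p >>.
Proof. by rewrite /path_elt unlock. Qed.

Definition path_mul2 (p q : qpath Q) : path_alg :=
  if path_comp p q is Some r then path_elt r else 0.

Section Extend.
Variable V : lmodType k.
Definition path_ext (h : qpath Q -> V) (f : path_alg) : V :=
  \sum_(p <- msupp f) mcoeff p f *: h p.

Lemma path_extw (D : {fset qpath Q}) h (f : path_alg) :
  (msupp f `<=` D)%fset -> path_ext h f = \sum_(p <- D) mcoeff p f *: h p.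
Proof.
move=> sfD; rewrite /path_ext; apply: big_fset_incl => // p _ pf.
by rewrite mcoeff_outdom // scale0r.
Qed.

Lemma path_ext_linear h : linear (path_ext h).
Proof.
move=> c f g; pose D := (msupp (c *: f + g) `|` (msupp f `|` msupp g))%fset.
rewrite (@path_extw D) ?fsubsetUl // (@path_extw D _ f); last first.
  by rewrite /D fsetUCA fsubsetUl.
rewrite (@path_extw D _ g); last by rewrite /D fsetUA fsubsetUr.
rewrite scaler_sumr -big_split; apply: eq_bigr => p _ /=.
by rewrite mcoeffD mcoeffZ scalerDl scalerA.
Qed.

Lemma path_ext_elt h p : path_ext h (path_elt p) = h p.
Proof. by rewrite /path_ext path_eltE msuppU oner_eq0 big_seq_fset1 mcoeffUU scale1r. Qed.
End Extend.

Lemma malg_scaleU (K : choiceType) (c : k) (x : K) :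
  << c *g x >> = c *: << x >> :> {malg k[K]}.
Proof. by apply/malgP => y; rewrite mcoeffZ !mcoeffU mulrnAr mulr1. Qed.

Lemma path_algE (f : path_alg) : f = \sum_(p <- msupp f) mcoeff p f *: path_elt p.
Proof. by rewrite {1}(monalgE f); apply: eq_bigr => p _; rewrite path_eltE; apply: malg_scaleU. Qed.

Lemma mcoeff_elt p q : mcoeff q (path_elt p) = (p == q)%:R.
Proof. by rewrite path_eltE mcoeffU. Qed.

Lemma eq_path_linear (V : lmodType k) (f g : path_alg -> V) :
  linear f -> linear g -> (forall p, f (path_elt p) = g (path_elt p)) -> f =1 g.
Proof.
move=> lf lg fg x; rewrite (path_algE x) (linear_sum_of lf) (linear_sum_of lg).
by apply: eq_bigr => p _; rewrite fg.
Qed.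

Definition path_mul : path_alg -> path_alg -> path_alg :=
  locked_with path_key (fun f g => path_ext (fun p => path_ext (path_mul2 p) g) f).
Lemma path_mulE f g : path_mul f g = path_ext (fun p => path_ext (path_mul2 p) g) f.
Proof. by rewrite /path_mul unlock. Qed.
Definition path_one : path_alg := \sum_(x : vertex Q) path_elt (path_id x).

Lemma path_mul_linl g : linear (path_mul^~ g).
Proof. by move=> c f h; rewrite !path_mulE path_ext_linear. Qed.
Lemma path_mul_linr f : linear (path_mul f).
Proof.
move=> c g h; rewrite !path_mulE /path_ext scaler_sumr -big_split.
apply: eq_bigr => p _; rewrite -!/(path_ext _ _) path_ext_linear scalerDr !scalerA.
by rewrite mulrC.
Qed.
Lemma path_mul_elt p q : path_mul (path_elt p) (path_elt q) = path_mul2 p q.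
Proof. by rewrite path_mulE !path_ext_elt. Qed.

Lemma path_mul0l f : path_mul 0 f = 0.
Proof. by have := path_mul_linl f (-1) 0 0; rewrite !scaleN1r !addNr. Qed.
Lemma path_mul0r f : path_mul f 0 = 0.
Proof. by have := path_mul_linr f (-1) 0 0; rewrite !scaleN1r !addNr. Qed.

Lemma path_mulDl : left_distributive path_mul +%R.
Proof. by move=> f g h; have := path_mul_linl h 1 f g; rewrite !scale1r. Qed.
Lemma path_mulDr : right_distributive path_mul +%R.
Proof. by move=> f g h; have := path_mul_linr f 1 g h; rewrite !scale1r. Qed.

Lemma path_mulZl c f g : path_mul (c *: f) g = c *: path_mul f g.
Proof. by rewrite -[c *: f]addr0 path_mul_linl path_mul0l addr0. Qed.
Lemma path_mulZr c f g : path_mul f (c *: g) = c *: path_mul f g.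
Proof. by rewrite -[c *: g]addr0 path_mul_linr path_mul0r addr0. Qed.

Lemma path_mulA : associative path_mul.
Proof.
move=> f g h; move: f; apply: eq_path_linear => [||p].
- exact: path_mul_linl.
- by apply: (comp_linear (f := path_mul^~ h)); apply: path_mul_linl.
move: g; apply: eq_path_linear => [||q].
- by apply: (comp_linear (f := path_mul _)); [apply: path_mul_linr | apply: path_mul_linl].
- by apply: (comp_linear (f := path_mul^~ h) (g := path_mul _));
    [apply: path_mul_linl | apply: path_mul_linr].
move: h; apply: eq_path_linear => [||r].
- by apply: (comp_linear (f := path_mul _)); apply: path_mul_linr.
- exact: path_mul_linr.
rewrite [LHS]/= (path_mul_elt q r) [RHS]/= (path_mul_elt p q).
move: (path_compA p q r); rewrite {1}/path_mul2 /(path_mul2 p q).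
case: (path_comp q r) => [u|]; case: (path_comp p q) => [v|]; rewrite /obind /oapp => E.
- by rewrite (path_mul_elt p u) (path_mul_elt v r) /path_mul2 E.
- by rewrite (path_mul_elt p u) path_mul0l /path_mul2 E.
- by rewrite (path_mul_elt v r) path_mul0r /path_mul2 -E.
by rewrite path_mul0l path_mul0r.
Qed.

Lemma path_mul1l : left_id path_one path_mul.
Proof.
apply: eq_path_linear => [||p]; [exact: path_mul_linr | by [] |].
rewrite /path_one -(eq_bigr _ (fun x _ => scale1r (path_elt (path_id x)))).
rewrite (linear_sum_of (path_mul_linl _)) (bigD1 (path_target p)) //=.
rewrite path_mul_elt /path_mul2 path_comp_idl eqxx scale1r big1 ?addr0 // => x ne.
by rewrite path_mul_elt /path_mul2 path_comp_idl eq_sym (negPf ne) scaler0.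
Qed.

Lemma path_mul1r : right_id path_one path_mul.
Proof.
apply: eq_path_linear => [||p]; [exact: path_mul_linl | by [] |].
rewrite /path_one -(eq_bigr _ (fun x _ => scale1r (path_elt (path_id x)))).
rewrite (linear_sum_of (path_mul_linr _)) (bigD1 (path_source p)) //=.
rewrite path_mul_elt /path_mul2 path_comp_idr eqxx scale1r big1 ?addr0 // => x ne.
by rewrite path_mul_elt /path_mul2 path_comp_idr eq_sym (negPf ne) scaler0.
Qed.

HB.instance Definition _ := GRing.Zmodule_isPzRing.Build path_alg
  path_mulA path_mul1l path_mul1r path_mulDl path_mulDr.

Lemma path_alg_mulE (p q : qpath Q) : path_elt p * path_elt q = path_mul2 p q.
Proof. exact: path_mul_elt. Qed.
Lemma path_alg_scalerAl (c : k) (f g : path_alg) : c *: (f * g) = (c *: f) * g.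
Proof. exact: esym (path_mulZl c f g). Qed.
Lemma path_alg_scalerAr (c : k) (f g : path_alg) : c *: (f * g) = f * (c *: g).
Proof. exact: esym (path_mulZr c f g). Qed.

Lemma mcoeff_idM x (f g : path_alg) :
  mcoeff (path_id x) (f * g) = mcoeff (path_id x) f * mcoeff (path_id x) g.
Proof.
have lin : linear (mcoeff (path_id x) : path_alg -> k^o).
  by move=> c u v; rewrite mcoeffD mcoeffZ.
move: f; apply: (@eq_path_linear k^o) => [||p].
- by apply: (comp_linear (f := mcoeff _ : path_alg -> k^o)) => //; apply: path_mul_linl.
- by move=> c u v /=; rewrite lin mulrDl scalerAl.
move: g; apply: (@eq_path_linear k^o) => [||q].
- by apply: (comp_linear (f := mcoeff _ : path_alg -> k^o)) => //; apply: path_mul_linr.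
- by move=> c u v /=; rewrite lin mulrDr scalerAr.
rewrite path_alg_mulE /path_mul2 !mcoeff_elt.
have := @path_comp_eq_id Q x p q.
have := path_comp_idl x (path_id x); rewrite [path_target _]/= eqxx.
case: (eqVneq p (path_id x)) => [-> | np]; case: (eqVneq q (path_id x)) => [-> | nq].
- by move=> -> _; rewrite mcoeff_elt eqxx mulr1.
- move=> _ H; rewrite mulr0; case: path_comp H => [r|] H; rewrite ?mcoeff0 // mcoeff_elt.
  by case: eqP => // rx; case: H nq => [|_ ->]; rewrite ?rx ?eqxx.
- move=> _ H; rewrite mul0r; case: path_comp H => [r|] H; rewrite ?mcoeff0 // mcoeff_elt.
  by case: eqP => // rx; case: H np => [|-> _]; rewrite ?rx ?eqxx.
move=> _ H; rewrite mul0r; case: path_comp H => [r|] H; rewrite ?mcoeff0 // mcoeff_elt.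
by case: eqP => // rx; case: H np => [|-> _]; rewrite ?rx ?eqxx.
Qed.

Lemma mcoeff_id1 x : mcoeff (path_id x) (1 : path_alg) = 1.
Proof.
rewrite -[1]/path_one /path_one raddf_sum (bigD1 x) //= mcoeff_elt eqxx big1 ?addr0 // => y ne.
rewrite mcoeff_elt; case: eqP => // /(congr1 (@path_source Q)) yx.
by move: ne; rewrite (yx : y = x) eqxx.
Qed.

End PathAlgebra.

Section Ideals.
Variable R : pzRingType.

Record two_sided_ideal (I : R -> Prop) : Prop := TwoSidedIdeal {
  ideal0 : I 0;
  idealD : forall x y, I x -> I y -> I (x + y);
  idealMl : forall r x, I x -> I (r * x);
  idealMr : forall x r, I x -> I (x * r)
}.

Definition ideal_gen (S : R -> Prop) (x : R) : Prop :=
  forall J : R -> Prop, two_sided_ideal J -> (forall s, S s -> J s) -> J x.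

Definition ideal_mul (I J : R -> Prop) : R -> Prop :=
  ideal_gen (fun x => exists a b, [/\ I a, J b & x = a * b]).

Fixpoint ideal_exp (I : R -> Prop) (n : nat) : R -> Prop :=
  if n is n'.+1 then ideal_mul I (ideal_exp I n') else fun _ => True.
End Ideals.

Section BoundQuiver.
Variable k : fieldType.

Definition arrow_ideal (Q : quiver) : path_alg k Q -> Prop :=
  ideal_gen (fun x => exists a : arrow Q, x = path_elt k (path_arrow a)).

Definition admissible (Q : quiver) (I : path_alg k Q -> Prop) : Prop :=
  two_sided_ideal I /\
  exists2 m, (2 <= m)%N &
    (forall x, ideal_exp (@arrow_ideal Q) m x -> I x) /\
    (forall x, I x -> ideal_exp (@arrow_ideal Q) 2 x).

(* Lambda = kQ / I, given as an algebra with a surjective k-algebra morphism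
   kQ -> Lambda whose kernel is I *)
Record bound_quiver_algebra := BoundQuiverAlgebra {
  bq_quiver : quiver;
  bq_ideal : path_alg k bq_quiver -> Prop;
  bq_admissible : admissible bq_ideal;
  bq_alg :> falgType k;
  bq_proj : {linear path_alg k bq_quiver -> bq_alg};
  bq_projM : monoid_morphism bq_proj;
  bq_surj : forall v, exists f, bq_proj f = v;
  bq_ker : forall f, bq_proj f = 0 <-> bq_ideal f
}.

Variable B : bound_quiver_algebra.
Implicit Types x y : vertex (bq_quiver B).

Definition bq_idem x : B := bq_proj B (path_elt k (path_id x)).

(* The augmentation at x: the coefficient of the trivial path at x in any
   preimage in kQ, which is well defined because I is contained in F. *)
Definition bq_lift (v : B) : path_alg k (bq_quiver B) := projT1 (cid (bq_surj v)).
Definition bq_aug x (v : B) : k := mcoeff (path_id x) (bq_lift v).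

Lemma arrow_ideal_coeff0 (Q : quiver) (f : path_alg k Q) (x : vertex Q) :
  arrow_ideal f -> mcoeff (path_id x) f = 0.
Proof.
move=> Ff; apply: (Ff (fun g => mcoeff (path_id x) g = 0)) => [|_ [a ->]]; last first.
  by rewrite mcoeff_elt; case: eqP => // /(congr1 val).
split=> [|f1 f2 H1 H2|r g H|g r H]; first exact: mcoeff0.
- by rewrite mcoeffD H1 H2 addr0.
- by rewrite mcoeff_idM H mulr0.
by rewrite mcoeff_idM H mul0r.
Qed.

Lemma bq_ideal_coeff0 x f : bq_ideal f -> mcoeff (path_id x) f = 0.
Proof.
have [_ [m _ [_ IF2]]] := bq_admissible B.
move=> /IF2 /= F2; apply: arrow_ideal_coeff0.
apply: F2 => [|_ [a [b [Fa _ ->]]]].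
  split=> [|f1 f2 H1 H2|r g H|g r H] J idJ FJ; have [J0 JD Jl Jr] := idJ => //.
  - by apply: JD; [apply: H1 | apply: H2].
  - by apply: Jl; apply: H.
  by apply: Jr; apply: H.
by move=> J idJ FJ; apply: (idealMr idJ); apply: Fa.
Qed.

Lemma bq_augE x f : bq_aug x (bq_proj B f) = mcoeff (path_id x) f.
Proof.
rewrite /bq_aug /bq_lift; case: cid => g /= gE; apply/eqP; rewrite -subr_eq0 -mcoeffB.
by apply/eqP/bq_ideal_coeff0/bq_ker; rewrite linearB gE subrr.
Qed.

Lemma bq_aug_linear x : linear (bq_aug x : B -> k^o).
Proof.
move=> c u v; have [f <-] := bq_surj u; have [g <-] := bq_surj v.
by rewrite -linearP !bq_augE mcoeffD mcoeffZ.
Qed.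
Lemma bq_aug1 x : bq_aug x 1 = 1.
Proof. by rewrite -(bq_projM B).1 bq_augE mcoeff_id1. Qed.
Lemma bq_augM x u v : bq_aug x (u * v) = bq_aug x u * bq_aug x v.
Proof.
have [f <-] := bq_surj u; have [g <-] := bq_surj v.
by rewrite -(bq_projM B).2 !bq_augE mcoeff_idM.
Qed.

Section Simple.
Variable x : vertex (bq_quiver B).
Definition simple_lact (v : B) (c : k^o) : k^o := bq_aug x v * c.
Definition simple_ract (c : k^o) (v : B) : k^o := c * bq_aug x v.
Lemma simple_lact_linl c : linear (simple_lact^~ c).
Proof. by move=> a u v; rewrite /simple_lact bq_aug_linear mulrDl scalerAl. Qed.
Lemma simple_lact_linr v : linear (simple_lact v).
Proof. by move=> a c d; rewrite /simple_lact mulrDr scalerAr. Qed.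
Lemma simple_lact1 c : simple_lact 1 c = c.
Proof. by rewrite /simple_lact bq_aug1 mul1r. Qed.
Lemma simple_lactM u v c : simple_lact (u * v) c = simple_lact u (simple_lact v c).
Proof. by rewrite /simple_lact bq_augM mulrA. Qed.
Lemma simple_ract_linl v : linear (simple_ract^~ v).
Proof. by move=> a c d; rewrite /simple_ract mulrDl scalerAl. Qed.
Lemma simple_ract_linr c : linear (simple_ract c).
Proof. by move=> a u v; rewrite /simple_ract bq_aug_linear mulrDr scalerAr. Qed.
Lemma simple_ract1 c : simple_ract c 1 = c.
Proof. by rewrite /simple_ract bq_aug1 mulr1. Qed.
Lemma simple_ractM c u v : simple_ract c (u * v) = simple_ract (simple_ract c u) v.
Proof. by rewrite /simple_ract bq_augM mulrA. Qed.

Definition simple_left : lmodule B :=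
  LModule simple_lact_linl simple_lact_linr simple_lact1 simple_lactM.
Definition simple_right : rmodule B :=
  RModule simple_ract_linl simple_ract_linr simple_ract1 simple_ractM.
End Simple.

(* y X x *)
Definition corner (X : bimodule B) y x : {vspace X} :=
  limg (lact_map X (tens (bq_idem y) (bq_idem x) : env B)).

End BoundQuiver.

(* Main.v *)
Require Import Defs.
From mathcomp Require Import all_boot all_algebra falgebra boolp monalg zify.

(** Write [L] for the algebra, [S_x] for its simple left modules, [P_i] for the
    minimal projective bimodule resolution of [L] and [h_i] for the dimension
    of the space of bimodule maps [P_i -> X]. The theorem combines two
    independent computations.

    The first one holds over any finite dimensional algebra. Maps from [X] into
    the dual of a right module [N] are the functionals on [N (x) X], and a
    projective [P] satisfies [P^* (x) X = Hom (P, X)] through a dual basis; so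
    [Hom (X, tau M)] is dual to the cokernel of
    [Hom (P_0, X) -> Hom (P_1, X)] ([dim_homA_tau]). Applied to a syzygy of [L],
    this says that the [n]-th tau-cohomology has the dimension of the degree [n]
    term of [Hom (P, X)] modulo coboundaries, that is, without the passage to
    cocycles. The Euler characteristic of the truncated complex then gives the
    alternating sum of the statement, with the [h_i] in place of the double sums
    ([euler_telescope]).

    The second one is Happel's description of [P_i]:
    [h_i] is the sum over [x] and [y] of
    [dim (y X x) * dim Ext^i (S_x, S_y)] ([cochain_dim_self]). Since [P_i] is
    projective, [h_i] is additive in [X], and the composition factors of [X] are
    the one-dimensional bimodules [simple_bimod y x], each occurring [dim (y X x)]
    times ([dim_homA_simples]). For a one-dimensional target [S], minimality of
    the resolution identifies [Hom (P_i, S)] with the maps from the [i]-th syzygy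
    to [S] ([dim_homA_cover]). Now [simple_bimod y x] is [S_y] with right
    multiplication through the augmentation at [x], so bimodule maps
    [M -> simple_bimod y x] are left module maps [M (x)_L S_x -> S_y]. As the
    syzygies of [L] are projective as right modules, the resolution stays exact
    when tensored with [S_x]. Its terms stay projective covers, because a
    redundant direct summand would have no map to any simple module. Hence the
    [i]-th bimodule syzygy of [L] becomes the [i]-th syzygy of [S_x] ([right_top_cover], [right_top_syzygy]).

    Tor is turned into Ext by the duality between [N (x) P] and [Hom (P, D N)]
    ([dim_Tor_Ext]); with it, the homological formulas are the cohomological
    ones for the dual bimodule of [X], whose corners are transposed
    ([corner_dual]). *)

Set Implicit Arguments.
Unset Strict Implicit.
Unset Printing Implicit Defensive.

Import GRing.Theory.
Local Open Scope ring_scope.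

(** * Functionals, pairings and dimensions *)

Section Linear.
Variable k : fieldType.
Implicit Types U V W : vectType k.

Lemma linear_sum_fun (U V : lmodType k) (f : U -> V) : linear f ->
  forall I (r : seq I) (x : I -> U), f (\sum_(i <- r) x i) = \sum_(i <- r) f (x i).
Proof.
move=> lf I r x; rewrite -(eq_bigr _ (fun i _ => scale1r (x i))) (linear_sum_of lf).
by apply: eq_bigr => i _; rewrite scale1r.
Qed.

Lemma dim_bij V W (S : {vspace V}) (T : {vspace W}) (f : 'Hom(V, W)) :
    (forall v, v \in S -> f v \in T) ->
    (forall v, v \in S -> f v = 0 -> v = 0) ->
    (forall w, w \in T -> exists2 v, v \in S & f v = w) ->
  \dim S = \dim T.
Proof.
move=> fST finj fsurj; have -> : T = (f @: S)%VS.
  apply/vspaceP => w; apply/idP/memv_imgP => [/fsurj[v Sv <-] | [v Sv ->]].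
    by exists v.
  exact: fST.
have := limg_ker_dim f S; suff -> : (S :&: lker f = 0)%VS by rewrite dimv0.
apply/eqP; rewrite -subv0; apply/subvP => v; rewrite memv_cap memv_ker memv0.
by case/andP=> Sv /eqP/finj->.
Qed.

Lemma dim_dual V : \dim {: 'Hom(V, k^o)} = \dim {: V}.
Proof. by rewrite !dimvf /dim /= muln1. Qed.

Definition annihilator V (S : {vspace V}) : {vspace 'Hom(V, k^o)} :=
  lker (precomp k^o (linfun (vsval : subvs_of S -> V))).

Lemma annihilatorP V (S : {vspace V}) (f : 'Hom(V, k^o)) :
  reflect (forall v, v \in S -> f v = 0) (f \in annihilator S).
Proof.
rewrite memv_ker precompE; apply: (iffP eqP) => [f0 v Sv | f0].
  by have /lfunP/(_ (vsproj S v)) := f0; rewrite comp_lfunE !lfunE /= vsprojK.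
by apply/lfunP => v; rewrite comp_lfunE !lfunE /= f0 ?subvsP.
Qed.

Lemma dim_annihilator V (S : {vspace V}) :
  (\dim (annihilator S) + \dim S)%N = \dim {: V}.
Proof.
pose r := precomp k^o (linfun (vsval : subvs_of S -> V)).
have := limg_ker_dim r fullv; rewrite capfv dim_dual => <-; congr addn.
suff -> : limg r = fullv by rewrite dim_dual dimvf.
apply/surjP => g; exists (g \o linfun (vsproj S \o projv S))%VF.
rewrite /r precompE; apply/lfunP => v; rewrite !comp_lfunE lfunE /= lfunE /=.
by rewrite projv_id ?subvsP // vsvalK.
Qed.

Lemma rank_precomp V W (f : 'Hom(V, W)) :
  \dim (limg (precomp k^o f)) = \dim (limg f).
Proof.
have := limg_ker_dim (precomp k^o f) fullv; rewrite capfv dim_dual.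
rewrite -(dim_annihilator (limg f)).
suff -> : lker (precomp k^o f) = annihilator (limg f) by move/addnI.
apply/vspaceP => g; rewrite memv_ker precompE; apply/eqP/annihilatorP => [g0 w | g0].
  by case/memv_imgP=> v _ ->; rewrite -comp_lfunE g0 lfunE.
by apply/lfunP => v; rewrite comp_lfunE lfunE /= g0 ?memv_img ?memvf.
Qed.

Lemma sep_functional V (S : {vspace V}) (v : V) : v \notin S ->
  exists2 f : 'Hom(V, k^o), f v != 0 & forall s, s \in S -> f s = 0.
Proof.
move=> nSv; have := dim_annihilator S; have := dim_annihilator (S + <[v]>)%VS.
have ltS : (\dim S < \dim (S + <[v]>)%VS)%N.
  by rewrite (ltn_leqif (dimv_leqif_sup (addvSl _ _))) subv_add subvv -memvE.
move=> <- dS; have : ~~ (annihilator S <= annihilator (S + <[v]>))%VS.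
  apply/negP => /dimvS; have := dS; lia.
case/subvPn => f /annihilatorP fS nf; exists f => //.
apply: contra nf => /eqP fv; apply/annihilatorP => _ /memv_addP[s Ss [w /vlineP[c ->] ->]].
by rewrite linearD linearZ /= fS // fv scaler0 addr0.
Qed.

Lemma vquot_repr V (S : {vspace V}) (v : V) :
  exists2 u, u \in S & vsval (vquot_proj S v) = v - u.
Proof. by exists (v - vsval (vquot_proj S v)); rewrite ?vquot_projK ?subKr. Qed.

Lemma dim_subquot V (Z S : {vspace V}) : (S <= Z)%VS ->
  (vdim (subquot Z S) + \dim S)%N = \dim Z.
Proof.
move=> SZ; rewrite /vdim /subquot dimvf /dim /=.
by rewrite -(dimv_cap_compl Z S) (capv_idPr SZ) addnC.
Qed.
End Linear.

(** A pairing that is non-degenerate on the left and represents every functional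
    killing [R] identifies [S] with the dual of [T / R]; the subspaces save
    passing to the quotient. *)
Lemma dim_pairing (k : fieldType) (U V : vectType k) (S : {vspace U})
    (T R : {vspace V}) (b : U -> V -> k^o) :
    bilin b -> (R <= T)%VS ->
    (forall u, u \in S -> (forall v, v \in T -> b u v = 0) -> u = 0) ->
    (forall u v, u \in S -> v \in R -> b u v = 0) ->
    (forall f : 'Hom(V, k^o), (forall v, v \in R -> f v = 0) ->
       exists2 u, u \in S & forall v, v \in T -> b u v = f v) ->
  (\dim S + \dim R)%N = \dim T.
Proof.
move=> [bl br] RT ndeg bR rep.
pose TT := subvs_of T; pose R' := (linfun (vsproj T) @: R)%VS.
have dR : \dim R' = \dim R.
  apply/esym/(@dim_bij k V TT _ _ (linfun (vsproj T))) => [v Rv|v Rv|w].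
  - exact: memv_img.
  - by rewrite lfunE /= => /(congr1 vsval); rewrite vsprojK ?(subvP RT) //= linear0.
  by case/memv_imgP=> v Rv ->; exists v.
have -> : \dim T = \dim {: TT} by rewrite dimvf.
rewrite -(dim_annihilator R') dR; congr addn.
pose h u : TT -> k^o := fun t => b u (vsval t).
have hl u : linear (h u) by move=> c s t; rewrite /h linearP br.
pose F u : 'Hom(TT, k^o) := linfun (h u).
have Fl : linear F.
  move=> c u v; apply/lfunP => t; rewrite add_lfunE scale_lfunE.
  by rewrite !(linfunE (hl _)) /h bl.
apply: (@dim_bij _ _ _ _ _ (linfun F)) => [u Su|u Su|g /annihilatorP gR].
- rewrite (linfunE Fl); apply/annihilatorP => _ /memv_imgP[v Rv ->].
  by rewrite (linfunE (hl _)) /h lfunE /= vsprojK ?(subvP RT) ?bR.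
- rewrite (linfunE Fl) => F0; apply: ndeg => // v Tv.
  by have /lfunP/(_ (vsproj T v)) := F0; rewrite (linfunE (hl _)) lfunE /h /= vsprojK.
have [v Rv|u Su uE] := rep (g \o linfun (vsproj T))%VF.
  by rewrite comp_lfunE gR // memv_img.
exists u => //; rewrite (linfunE Fl); apply/lfunP => t.
by rewrite (linfunE (hl _)) /h uE ?subvsP // comp_lfunE lfunE /= vsvalK.
Qed.

(** * Dimensions of Ext and the truncated Euler characteristic *)
Section Euler.
Variables (k : fieldType) (A : falgType k).
Implicit Types (M X P : lmodule A).

Definition cochain_dim M X n : nat := \dim (homA (res M n) X).
Definition cochain_rank M X n : nat :=
  \dim (precomp X (res_d M n) @: homA (res M n) X).

Lemma dim_cocycle M X n :
  (\dim (Ext_cocycle M X n) + cochain_rank M X n)%N = cochain_dim M X n.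
Proof. exact: limg_ker_dim. Qed.

Lemma dim_Ext M X n :
  (vdim (Ext n M X) + \dim (Ext_cobound M X n) + cochain_rank M X n)%N
  = cochain_dim M X n.
Proof. by rewrite dim_subquot ?dim_cocycle ?Ext_cobound_sub. Qed.

(** The left-hand side is the dimension of the cokernel of the last
    differential. In the alternating sum the ranks of the earlier
    differentials cancel in pairs. *)
Lemma euler_telescope M X n :
  ((cochain_dim M X n)%:Z - (\dim (Ext_cobound M X n))%:Z)
  = (-1) ^+ n * (\sum_(i < n) (-1) ^+ i.+1 * (vdim (Ext i M X))%:Z
                 + \sum_(i < n.+1) (-1) ^+ i * (cochain_dim M X i)%:Z).
Proof.
elim: n => [|n IHn].
  by rewrite big_ord0 big_ord1 dimv0 subr0 !expr0 !mul1r add0r.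
rewrite big_ord_recr [X in _ * (_ + X)]big_ord_recr /= addrACA mulrDr exprS -!mulrA mulN1r -IHn.
have ss : (-1) ^+ n * (-1) ^+ n = 1 :> int by rewrite -exprMn mulrNN mulr1 expr1n.
have sN (c : int) : (-1) ^+ n * (- 1 * ((-1) ^+ n * c)) = - c.
  by rewrite mulrCA mulN1r mulrA ss mul1r.
rewrite mulrDr !mulN1r !mulrN !mulrA ss !mul1r -(dim_Ext M X n) !PoszD /cochain_rank.
move: (vdim _) (\dim _)%N (\dim _)%N (cochain_dim _ _ _) => e b r h.
lia.
Qed.

(** Split the free cover of [P]: the coordinates of the splitting are the
    functionals [f i]. *)
Lemma projective_dual_basis P : projective P ->
  exists d (p : 'I_d -> P) (f : 'I_d -> star P),
    forall v, v = \sum_i lact (vsval (f i : subvs_of (homA P (reg_mod A))) v : A) (p i).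
Proof.
move=> Pproj; set d := \dim {: P}; pose p (i : 'I_d) := (vbasis {: P})`_i.
have idA : \1%VF \in homA P P by apply/homAP => a v; rewrite !lfunE.
have [h hA hK] := Pproj _ _ _ _ (free_homA p) (free_surj P) idA.
have fl i : linear (fun v : P => (h v : {ffun 'I_d -> A}) i).
  by move=> c u v; rewrite linearP !ffunE.
pose f i : 'Hom(P, reg_mod A) := linfun (fun v : P => (h v : {ffun 'I_d -> A}) i : reg_mod A).
have fA i : f i \in homA P (reg_mod A).
  by apply/homAP => a v; rewrite !(linfunE (fl i)) (homAP hA) ffunE.
exists d, p, (fun i => vsproj _ (f i)) => v.
have /lfunP/(_ v) := hK; rewrite comp_lfunE free_homE lfunE /= => {1}<-.
by apply: eq_bigr => i _; rewrite vsprojK // (linfunE (fl i)).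
Qed.
End Euler.

(** * The transpose and the Auslander-Reiten translate *)
Section Translate.
Variables (k : fieldType) (A : falgType k).
Implicit Types (M X P : lmodule A).

Definition star_eval P (f : star P) (v : P) : A :=
  vsval (f : subvs_of (homA P (reg_mod A))) v.

Lemma star_eval_lact P (f : star P) a v : star_eval f (lact a v) = a * star_eval f v.
Proof. exact: (homAP (subvsP (f : subvs_of (homA P (reg_mod A))))). Qed.

Lemma star_eval_linr P (f : star P) : linear (star_eval f).
Proof. by move=> c u v; rewrite /star_eval linearP. Qed.

Lemma star_eval_linl P v : linear (fun f : star P => star_eval f v).
Proof. by move=> c f g; rewrite /star_eval star_linE. Qed.

(** The image of [f (x) x] under [P^* (x) X -> Hom (P, X)]. *)
Definition rank_one P X (f : star P) (x : X) : 'Hom(P, X) :=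
  linfun (fun v => lact (star_eval f v) x).

Lemma rank_oneE P X (f : star P) (x : X) v : rank_one f x v = lact (star_eval f v) x.
Proof. by apply: linfunE => c u w; rewrite star_eval_linr lact_linl. Qed.

Lemma rank_one_homA P X (f : star P) (x : X) : rank_one f x \in homA P X.
Proof. by apply/homAP => a v; rewrite !rank_oneE star_eval_lact lactM. Qed.

Lemma rank_one_linl P X (x : X) : linear (fun f : star P => rank_one f x).
Proof.
move=> c f g; apply/lfunP => v.
by rewrite add_lfunE scale_lfunE !rank_oneE star_eval_linl lact_linl.
Qed.

Lemma rank_one_linr P X (f : star P) : linear (fun x : X => rank_one f x).
Proof.
by move=> c x y; apply/lfunP => v; rewrite add_lfunE scale_lfunE !rank_oneE lact_linr.
Qed.

Section DualBasis.
Variables (P : lmodule A) (d : nat) (p : 'I_d -> P) (f : 'I_d -> star P).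
Hypothesis pfK : forall v, v = \sum_i lact (star_eval (f i) v) (p i).

Lemma dual_basis_hom X (g : 'Hom(P, X)) : g \in homA P X ->
  g = \sum_i rank_one (f i) (g (p i)).
Proof.
move=> /homAP gA; apply/lfunP => v; rewrite sum_lfunE {1}(pfK v) linear_sum.
by apply: eq_bigr => i _; rewrite rank_oneE; apply: gA.
Qed.

Lemma dual_basis_star (h : star P) : h = \sum_i ract (f i) (star_eval h (p i)).
Proof.
apply: starP => v; rewrite (raddf_sum vsval) sum_lfunE -/(star_eval h v) {1}(pfK v).
rewrite (linear_sum_fun (star_eval_linr h)).
apply: eq_bigr => i _; rewrite star_eval_lact.
exact: esym (star_actE _ _ _).
Qed.
End DualBasis.

(** A map [u] from [X] to [D (Tr M)] pairs with [g : P_1 -> X] by contracting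
    [g], seen in [P_1^* (x) X], with [u]. The pairing is written with dual bases,
    [sum_i u (g p_i) [f_i]], but its value on [rank_one f x] is [u x [f]], whatever
    the basis. It kills the maps that factor through [P_0] because
    [Tr M] is the cokernel of [P_0^* -> P_1^*]. *)
Lemma dim_homA_tau M X :
  (\dim (homA X (tau M)) + \dim (precomp X (cover_d M) @: homA (pcover M) X)%VS)%N
  = \dim (homA (pcover (syzygy1 M)) X).
Proof.
set P0 := pc_mod (pcover M); set P1 := pc_mod (pcover (syzygy1 M)); set D := cover_d M.
have DA : D \in homA P1 P0 := cover_d_hom M.
have [d1 [p1 [f1 pfK1]]] := projective_dual_basis (@pc_proj k A _ (pcover (syzygy1 M))).
have [d0 [p0 [f0 pfK0]]] := projective_dual_basis (@pc_proj k A _ (pcover M)).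
pose pi := vquot_proj (limg (star_map D) : {vspace star P1}).
have pi_star (f : star P0) : pi (star_map D f) = 0.
  by apply/eqP; rewrite vquot_proj_eq0 memv_img ?memvf.
have pi_act f a : pi (ract f a) = ract (pi f : Tr M) a.
  by rewrite [RHS](quo_actE (star_map_rsubmodule DA)).
pose ev (b : 'Hom(X, tau M)) (x : X) (f : star P1) : k^o := (b x : 'Hom(Tr M, k^o)) (pi f).
have ev_lin b x : linear (ev b x) by move=> c f g; rewrite /ev !linearP.
have ev_act b x f a : b \in homA X (tau M) -> ev b (lact a x) f = ev b x (ract f a).
  move=> /homAP bA; rewrite /ev bA pi_act.
  exact: (dual_actE (N := Tr M)).
pose b (u : 'Hom(X, tau M)) (g : 'Hom(P1, X)) : k^o := \sum_i ev u (g (p1 i)) (f1 i).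
have b_rank1 u f x : u \in homA X (tau M) -> b u (rank_one f x) = ev u x f.
  move=> uA; rewrite {2}(dual_basis_star pfK1 f).
  rewrite (linear_sum_fun (ev_lin u x)).
  by apply: eq_bigr => i _; rewrite rank_oneE ev_act.
have blin : bilin b.
  split=> [g|u] c v w; rewrite /b scaler_sumr -big_split; apply: eq_bigr => i _ /=.
    by rewrite /ev !(add_lfunE, scale_lfunE).
  by rewrite /ev !(add_lfunE, scale_lfunE) linearP !(add_lfunE, scale_lfunE).
have b0 u : b u 0 = 0 by have := blin.2 u (-1) 0 0; rewrite !scaleN1r !addNr.
have comp_rank1 (f : star P0) (x : X) : precomp X D (rank_one f x) = rank_one (star_map D f) x.
  apply/lfunP => v; rewrite precompE comp_lfunE !rank_oneE; congr (lact _ _).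
  by rewrite /star_eval star_mapE.
apply: (dim_pairing blin).
- by apply/subvP => _ /memv_imgP[g gA ->]; rewrite precompE homA_comp.
- move=> u uA u0; apply/lfunP => x; rewrite lfunE /=; apply/lfunP => q; rewrite lfunE /=.
  rewrite -(vsvalQK q) -/pi -[LHS]/(ev u x (vsval q)) -b_rank1 //.
  by rewrite u0 ?rank_one_homA.
- move=> u _ uA /memv_imgP[g gA ->]; rewrite (dual_basis_hom pfK0 gA) linear_sum.
  rewrite (linear_sum_fun (blin.2 u)); apply: big1 => i _.
  apply: etrans (congr1 (b u) (comp_rank1 _ _)) _.
  by rewrite b_rank1 // /ev pi_star linear0.
move=> phi phi0; pose w x (q : Tr M) : k^o := phi (rank_one (vsval q) x).
have wl x : linear (w x) by move=> c q r; rewrite /w linearP rank_one_linl linearP.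
pose W (x : X) : tau M := linfun (w x).
have Wl : linear W.
  move=> c x y; apply/lfunP => q; rewrite add_lfunE scale_lfunE !(linfunE (wl _)).
  by rewrite /w rank_one_linr linearP.
have ev_W x f : (W x : 'Hom(Tr M, k^o)) (pi f) = phi (rank_one f x).
  rewrite (linfunE (wl x)) /w; apply/eqP; rewrite eq_sym -subr_eq0 -linearB.
  have -> : rank_one f x - rank_one (vsval (pi f)) x = rank_one (f - vsval (pi f)) x.
    have := rank_one_linl x (-1) (vsval (pi f)) f; rewrite !scaleN1r addrC => <-.
    by rewrite addrC.
  have /memv_imgP[h _ ->] := vquot_projK (limg (star_map D)) f.
  rewrite -comp_rank1; apply/eqP/phi0/memv_img.
  exact: rank_one_homA.
have WA : linfun W \in homA X (tau M).
  apply/homAP => a x; rewrite !(linfunE Wl); apply/lfunP => q.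
  rewrite -(vsvalQK q) -/pi ev_W.
  apply: (etrans _ (esym (dual_actE (N := Tr M) _ _ _))).
  rewrite -pi_act ev_W; congr (phi _); apply/lfunP => v; rewrite !rank_oneE -lactM.
  by congr (lact _ _); apply: esym; apply: star_actE.
exists (linfun W) => // g gA; rewrite (dual_basis_hom pfK1 gA).
rewrite (linear_sum_fun (blin.2 _)) linear_sum; apply: eq_bigr => i _.
by rewrite b_rank1 // /ev (linfunE Wl) ev_W.
Qed.
End Translate.

(** * Duality between Tor and Ext *)
Section TensorDuality.
Variables (k : fieldType) (A : falgType k) (N : rmodule A).
Implicit Types (P Q : lmodule A).

Lemma tensA_rel_sub P (V : vectType k) (h : 'Hom(vtens N P, V)) :
    (forall n a p, h (tens (ract n a) p) = h (tens n (lact a p))) ->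
  forall t, t \in tensA_rel N P -> h t = 0.
Proof.
move=> hN t; suff /subvP sub : (tensA_rel N P <= lker h)%VS.
  by move=> /sub; rewrite memv_ker => /eqP.
apply/subv_sumP => i _; apply/subv_sumP => j _; apply/subv_sumP => l _.
by rewrite -memvE memv_ker linearB /= hN subrr.
Qed.

Definition tens_class P (n : N) (p : P) : tensA N P := vquot_proj (tensA_rel N P) (tens n p).

Lemma tens_class_linl P p : linear (fun n => @tens_class P n p).
Proof. by move=> c n n'; rewrite /tens_class tens_linl linearP. Qed.

Lemma tens_class_linr P n : linear (@tens_class P n).
Proof. by move=> c p p'; rewrite /tens_class tens_linr linearP. Qed.

Lemma tens_class_act P n a (p : P) : tens_class (ract n a) p = tens_class n (lact a p).
Proof. by apply/eqP; rewrite -subr_eq0 -linearB vquot_proj_eq0 tensA_relP. Qed.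

Lemma tensA_map_class P Q (g : 'Hom(P, Q)) n p : g \in homA P Q ->
  tensA_map N g (tens_class n p) = tens_class n (g p).
Proof.
move=> /homAP gA.
pose h : 'Hom(vtens N P, tensA N Q) :=
  linfun (vquot_proj (tensA_rel N Q) \o tens_map (idfun : N -> N) g).
have hE n' p' : h (tens n' p') = tens_class n' (g p').
  rewrite lfunE /= /tens_map tlift_tens //; split=> [v | v] c x y; first by rewrite tens_linl.
  by rewrite linearP tens_linr.
have [u ru uE] := vquot_repr (tensA_rel N P) (tens n p).
have -> : tensA_map N g (tens_class n p) = h (vsval (tens_class n p)) by rewrite !lfunE.
rewrite uE linearB /= hE (tensA_rel_sub _ ru) ?subr0 // => n' a p'.
by rewrite !hE tens_class_act gA.
Qed.

(** The adjunction between tensoring with [N] and [Hom (N, -)], with target [k]. *)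
Definition curry_fun P (phi : 'Hom(tensA N P, k^o)) (p : P) : dual_mod N :=
  linfun (fun n => phi (tens_class n p)).

Lemma curry_funE P phi (p : P) n :
  (curry_fun phi p : 'Hom(N, k^o)) n = phi (tens_class n p).
Proof. by apply: linfunE => c u v; rewrite tens_class_linl linearP. Qed.

Definition curry P (phi : 'Hom(tensA N P, k^o)) : 'Hom(P, dual_mod N) :=
  linfun (curry_fun phi).

Lemma curryE P phi (p : P) n : (curry phi p : 'Hom(N, k^o)) n = phi (tens_class n p).
Proof.
rewrite linfunE ?curry_funE // => c u v; apply/lfunP => m.
by rewrite add_lfunE scale_lfunE !curry_funE tens_class_linr linearP.
Qed.

Lemma curry_linear P : linear (@curry P).
Proof.
move=> c f g; apply/lfunP => p; rewrite add_lfunE scale_lfunE; apply/lfunP => n.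
by rewrite add_lfunE scale_lfunE !curryE add_lfunE scale_lfunE.
Qed.

Lemma curry_homA P phi : curry phi \in homA P (dual_mod N).
Proof.
apply/homAP => a p; apply/lfunP => n; rewrite curryE -tens_class_act -curryE.
exact: esym (dual_actE a (curry phi p) n).
Qed.

Lemma curry_inj P (phi : 'Hom(tensA N P, k^o)) : curry phi = 0 -> phi = 0.
Proof.
move=> c0; apply/lfunP => q; rewrite lfunE /= -(vsvalQK q).
have := @eq_tens_linear k k^o N P (phi \o vquot_proj (tensA_rel N P))
  (fun=> 0) _ _ _ (vsval q).
apply=> [c u v|c u v|n p] /=; first by rewrite !linearP.
  by rewrite scaler0 addr0.
by rewrite -[LHS]curryE c0 !zero_lfunE.
Qed.

Lemma curry_surj P (f : 'Hom(P, dual_mod N)) : f \in homA P (dual_mod N) ->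
  exists phi, curry phi = f.
Proof.
move=> /homAP fA; pose b (n : N) (p : P) : k^o := (f p : 'Hom(N, k^o)) n.
have bl : bilin b.
  by split=> [p | n] c x y; rewrite /b ?linearP // add_lfunE scale_lfunE.
pose h : 'Hom(vtens N P, k^o) := linfun (tlift b).
have hE n p : h (tens n p) = b n p by rewrite lfunE /= tlift_tens.
exists (linfun (h \o vsval)); apply/lfunP => p; apply/lfunP => n; rewrite curryE lfunE /=.
have [u ru ->] := vquot_repr (tensA_rel N P) (tens n p).
rewrite linearB /= hE (tensA_rel_sub _ ru) ?subr0 // => n' a p'.
rewrite !hE /b fA; exact: esym (dual_actE a (f p') n').
Qed.

Lemma curry_precomp P Q (g : 'Hom(P, Q)) (phi : 'Hom(tensA N Q, k^o)) : g \in homA P Q ->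
  curry (phi \o tensA_map N g)%VF = (curry phi \o g)%VF.
Proof.
move=> gA; apply/lfunP => p; apply/lfunP => n.
by rewrite curryE !comp_lfunE curryE tensA_map_class.
Qed.

Lemma dim_tensA P : \dim {: tensA N P} = \dim (homA P (dual_mod N)).
Proof.
rewrite -dim_dual; apply: (@dim_bij _ _ _ _ _ (linfun (@curry P))) => [phi _|phi _|f fA].
- by rewrite (linfunE (@curry_linear P)) curry_homA.
- by rewrite (linfunE (@curry_linear P)) => /curry_inj.
have [phi <-] := curry_surj fA.
by exists phi; rewrite ?memvf ?(linfunE (@curry_linear P)).
Qed.

Lemma rank_tensA_map P Q (g : 'Hom(P, Q)) : g \in homA P Q ->
  \dim (limg (tensA_map N g)) = \dim (precomp (dual_mod N) g @: homA Q (dual_mod N)).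
Proof.
move=> gA; rewrite -rank_precomp.
have lE := linfunE (@curry_linear P).
apply: (@dim_bij _ _ _ _ _ (linfun (@curry P))) => [phi|phi _|f].
- case/memv_imgP=> psi _ ->; rewrite lE precompE curry_precomp // -precompE.
  by apply: memv_img; apply: curry_homA.
- by rewrite lE => /curry_inj.
case/memv_imgP=> f' f'A ->; have [psi <-] := curry_surj f'A.
exists (precomp k^o (tensA_map N g) psi); first by rewrite memv_img ?memvf.
by rewrite lE !precompE curry_precomp.
Qed.

(** A vector outside the kernel is detected by a functional, and functionals on the
    tensor product are maps into [dual_mod N] by currying. *)
Lemma tensA_map_comp0 P Q (R : lmodule A) (g : 'Hom(P, Q)) (h : 'Hom(Q, R)) :
    g \in homA P Q -> h \in homA Q R -> (h \o g = 0)%VF ->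
  (limg (tensA_map N g) <= lker (tensA_map N h))%VS.
Proof.
move=> gA hA hg0; apply/subvP => _ /memv_imgP[t _ ->]; rewrite memv_ker.
apply: contraT; rewrite -memv0 => /sep_functional[phi nz _]; case/eqP: nz.
suff /lfunP/(_ t) : ((phi \o tensA_map N h) \o tensA_map N g = 0)%VF.
  by rewrite !comp_lfunE => ->; rewrite lfunE.
by apply: curry_inj; rewrite !curry_precomp // -comp_lfunA hg0 comp_lfun0r.
Qed.

(** By [curry], the complex computing Ext is the dual of the one computing Tor;
    the two therefore have the same dimensions and ranks. *)
Lemma dim_Tor_Ext n M : vdim (Tor n N M) = vdim (Ext n M (dual_mod N)).
Proof.
have boundE : \dim (Tor_bound N M n) = cochain_rank M (dual_mod N) n.
  exact: rank_tensA_map (cover_d_hom _).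
have [sub cycleE] : (Tor_bound N M n <= Tor_cycle N M n)%VS /\
    (\dim (Tor_cycle N M n) + \dim (Ext_cobound M (dual_mod N) n))%N
    = cochain_dim M (dual_mod N) n.
  case: (n) => [|i]; first by rewrite subvf dimv0 addn0 dim_tensA.
  split; first by apply: tensA_map_comp0; rewrite ?cover_d_hom // res_dd.
  have rE := rank_tensA_map (cover_d_hom (syzygy i M)).
  by rewrite -[Ext_cobound _ _ _]/(precomp _ _ @: _)%VS -rE /Tor_cycle
    -{1}[lker _]capfv limg_ker_dim dim_tensA.
have := dim_subquot sub; have := dim_Ext M (dual_mod N) n.
by rewrite boundE -/(Tor n N M); lia.
Qed.
End TensorDuality.

(** * Invariance of Ext *)
Section Isomorphism.
Variables (k : fieldType) (A : falgType k).

Lemma dim_Ext_iso n (M X Y : lmodule A) (g : 'Hom(X, Y)) :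
    g \in homA X Y -> lker g = 0%VS -> limg g = fullv ->
  vdim (Ext n M X) = vdim (Ext n M Y).
Proof.
move=> gA /eqP ker0 /surjP gs.
have postK i (f : 'Hom(res M i, X)) : (g \o f = 0)%VF -> f = 0.
  move=> gf0; apply/lfunP => v; have /lfunP/(_ v) := gf0.
  by rewrite comp_lfunE !lfunE /= => /eqP; rewrite -(linear0 g) => /eqP/(lker0P ker0).
have homE i (f : 'Hom(res M i, Y)) : f \in homA (res M i) Y ->
    exists2 f', f' \in homA (res M i) X & (g \o f')%VF = f.
  move=> /homAP fA; exists (g^-1 \o f)%VF.
    apply/homAP => a v; apply: (lker0P ker0).
    by rewrite (homAP gA) !comp_lfunE !limg_lfunVK ?fA //; apply/memv_imgP;
      [have [x <-] := gs (f v) | have [x <-] := gs (lact a (f v))]; exists x; rewrite ?memvf.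
  apply/lfunP => v; rewrite !comp_lfunE limg_lfunVK //.
  by have [x <-] := gs (f v); rewrite memv_img ?memvf.
have dimH i : cochain_dim M X i = cochain_dim M Y i.
  apply: (@dim_bij _ _ _ _ _ (postcomp _ g)) => [f fA|f _|f /homE[f' f'A <-]].
  - by rewrite postcompE homA_comp.
  - by rewrite postcompE => /postK.
  by exists f'; rewrite ?postcompE.
have dimR i : cochain_rank M X i = cochain_rank M Y i.
  apply: (@dim_bij _ _ _ _ _ (postcomp _ g)) => [_ /memv_imgP[f fA ->]|f _|].
  - rewrite !precompE postcompE comp_lfunA -precompE.
    by apply: memv_img; apply: homA_comp.
  - by rewrite postcompE; apply: (postK i.+1).
  move=> _ /memv_imgP[f /homE[f' f'A <-] ->].
  exists (precomp _ (res_d M i) f'); first exact: memv_img.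
  by rewrite postcompE !precompE comp_lfunA.
have := dim_Ext M X n; rewrite dimH -(dim_Ext M Y n) dimR.
have -> : \dim (Ext_cobound M X n) = \dim (Ext_cobound M Y n).
  by case: (n) => [|i] /=; rewrite ?dimv0 //; apply: dimR.
by move=> /addIn /addIn.
Qed.
End Isomorphism.

(** * The radical and tops of left modules *)
Section Radical.
Variables (k : fieldType) (B : bound_quiver_algebra k).
Implicit Types (x y : vertex (bq_quiver B)) (u v a b : B).

Lemma aug_idem x y : bq_aug x (bq_idem y) = (x == y)%:R.
Proof.
rewrite /bq_idem bq_augE mcoeff_elt; congr (_%:R).
by apply: congr1; apply/eqP/eqP => [/(congr1 (@path_source _))|->].
Qed.

Lemma sum_idem : \sum_x bq_idem x = 1 :> B.
Proof. by rewrite -(bq_projM B).1 /bq_idem -linear_sum. Qed.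

Lemma idem_mul x y : bq_idem x * bq_idem y = if y == x then bq_idem x else 0 :> B.
Proof.
rewrite -(bq_projM B).2 path_alg_mulE /path_mul2 path_comp_idl /path_target /=.
by case: eqP => [->|_]; rewrite ?linear0.
Qed.

Definition in_radical u := forall x, bq_aug x u = 0.

Lemma mem_arrow_ideal (f : path_alg k (bq_quiver B)) :
  (forall x, mcoeff (path_id x) f = 0) -> arrow_ideal f.
Proof.
move=> f0 K idK arK; have [K0 KD Kl Kr] := idK; rewrite (path_algE f) big_seq.
apply: (big_ind K) => // p _.
suff [[x ->]|Kp] : (exists x, p = path_id x) \/ K (path_elt k p).
- by rewrite f0 scale0r.
- by rewrite -[path_elt k p]mul1r path_alg_scalerAl; apply: Kl.
case: p => [[x [|a s]] w]; first by left; exists x; apply: val_inj.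
right; have /andP[/eqP sa ws] : (source a == x) && walk (target a) s := w.
suff -> : path_elt k (QPath w) = path_elt k (@QPath _ (target a, s) ws) * path_elt k (path_arrow a).
  by apply: Kl; apply: arK; exists a.
rewrite path_alg_mulE /path_mul2.
case: (path_compP (@QPath _ (target a, s) ws) (path_arrow a)) => [[r [_ -> rE]]|[]] //.
by congr path_elt; apply: val_inj; rewrite rE /= /path_source /= sa.
Qed.

(** A radical element lifts to the arrow ideal, a power of which consists of
    relations. *)
Lemma radical_nilpotent : exists m, forall s : seq B, size s = m ->
  (forall u, u \in s -> in_radical u) -> \prod_(u <- s) u = 0.
Proof.
have [_ [m _ [FmI _]]] := bq_admissible B.
exists m => s sm sJ; suff [f Ff <-] : exists2 f, ideal_exp (@arrow_ideal k (bq_quiver B)) m f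
    & bq_proj B f = \prod_(u <- s) u by apply/bq_ker/FmI.
elim: m s sm sJ {FmI} => [|m IHm] [|u s] //= => [_ _|[sm] sJ].
  by exists 1; rewrite // big_nil (bq_projM B).1.
have [||f Ff fE] := IHm s => // [v sv|]; first by apply: sJ; rewrite inE sv orbT.
have [g gE] := bq_surj u.
have Fg : arrow_ideal g.
  by apply: mem_arrow_ideal => x; rewrite -bq_augE gE; apply: sJ; rewrite mem_head.
exists (g * f); last by rewrite (bq_projM B).2 fE gE big_cons.
by move=> K idK; apply; exists g, f.
Qed.

(** Multiply [w] by radical elements as long as the result is non-zero, which
    stops because the radical is nilpotent, and project with a vertex idempotent:
    on vectors killed by the radical, the image of such an idempotent consists
    of eigenvectors. Both orders of multiplication are needed, since the
    functionals on a left module form a right module. *)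
Lemma joint_eigenvector (W : vectType k) (rho : B -> W -> W) (w : W) :
    (forall w, linear (rho^~ w)) -> (forall w, rho 1 w = w) ->
    (forall a b w, rho (a * b) w = rho a (rho b w)) \/
    (forall a b w, rho (a * b) w = rho b (rho a w)) ->
    w != 0 ->
  exists c x, rho c w != 0 /\ forall a, rho a (rho c w) = bq_aug x a *: rho c w.
Proof.
move=> rhol rho1 rhoM0 nzw.
(* [mu] is the product in the order in which the operators [rho a] compose. *)
have [mu [rhoM muJ muI]] : exists mu : B -> B -> B,
    [/\ forall a b w, rho (mu a b) w = rho a (rho b w),
        forall x a b, bq_aug x (mu a b) = bq_aug x a * bq_aug x b
      & exists m, forall s : seq B, size s = m ->
          (forall u, u \in s -> in_radical u) -> foldr mu 1 s = 0].
  have [m nil] := radical_nilpotent.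
  case: rhoM0 => rhoM; [exists (fun a b => a * b) | exists (fun a b => b * a)].
    split=> // [x a b|]; first exact: bq_augM.
    by exists m => s sm sJ; rewrite -(nil s) // unlock; elim: (s) => //= u s' ->.
  split=> // [x a b|]; first by rewrite bq_augM mulrC.
  exists m => s sm sJ; rewrite -(nil (rev s)) ?size_rev // => [|u]; last first.
    by rewrite mem_rev; apply: sJ.
  by elim: (s) => [|u s' IHs]; rewrite ?big_nil //= IHs rev_cons big_rcons.
have rho0 w' : rho 0 w' = 0 by have := rhol w' (-1) 0 0; rewrite !scaleN1r !addNr.
have [c nzc cJ] : exists2 c, rho c w != 0 & forall u, in_radical u -> rho u (rho c w) = 0.
  have [m nil] := muI.
  have {nil}: forall s, size s = m -> (forall u, u \in s -> in_radical u) -> foldr rho w s = 0.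
    move=> s sm sJ; have -> : foldr rho w s = rho (foldr mu 1 s) w.
      by elim: (s) => [|u s' IHs] /=; rewrite ?rho1 // rhoM IHs.
    by rewrite nil.
  elim: m w nzw => [|m IHm] w nzw nil.
    by move: nzw; rewrite -[w]/(foldr rho w [::]) nil ?eqxx.
  have [[u [Ju nzu]]|noJ] := pselect (exists u, in_radical u /\ rho u w != 0); last first.
    exists 1; rewrite rho1 // => u Ju; apply/eqP; apply: contraT => nz.
    by case: noJ; exists u.
  have [s sm sJ|c nzc cJ] := IHm _ nzu.
    rewrite -[LHS](foldr_rcons _ _ _ _) nil ?size_rcons ?sm // => v.
    by rewrite mem_rcons inE => /predU1P[->|/sJ].
  by exists (mu c u); rewrite rhoM.
have [x nzx] : exists x, rho (bq_idem x) (rho c w) != 0.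
  apply: contrapT => none; case/eqP: nzc; rewrite -[LHS]rho1 -sum_idem.
  rewrite (linear_sum_fun (rhol _)) big1 // => x _.
  by apply/eqP; apply: contraT => nz; case: none; exists x.
exists (mu (bq_idem x) c), x; rewrite rhoM; split=> // a.
apply/eqP; rewrite -subr_eq0 -rhoM.
have /= rhoB := rhol (rho c w) (- bq_aug x a) (bq_idem x) (mu a (bq_idem x)).
rewrite -scaleNr addrC -rhoB; apply/eqP/cJ => y.
rewrite bq_aug_linear muJ aug_idem; case: eqP => [->|_]; last by rewrite mulr0 addr0 scaler0.
by rewrite mulr1 -[_ *: _]/(_ * _) mulr1 addNr.
Qed.

(** A joint eigenvector among the functionals on [M] is a map to a simple
    module. *)
Lemma left_top (M : lmodule B) (v : M) : v != 0 ->
  exists x (f : 'Hom(M, simple_left x)), f \in homA M (simple_left x) /\ f != 0.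
Proof.
rewrite -memv0 => /sep_functional[w nzw _].
pose rho (a : B) (f : 'Hom(M, k^o)) : 'Hom(M, k^o) := (f \o lact_map M a)%VF.
have rhoE a f m : rho a f m = f (lact a m) by rewrite comp_lfunE lfunE.
have nz0 : w != 0 by apply: contraNneq nzw => ->; rewrite lfunE.
have [|f||c [x [nzf fE]]] := @joint_eigenvector _ rho w _ _ _ nz0.
- by move=> f c a b; apply/lfunP => m; rewrite add_lfunE scale_lfunE !rhoE lact_linl linearP.
- by apply/lfunP => m; rewrite rhoE lact1.
- by right=> a b f; apply/lfunP => m; rewrite !rhoE lactM.
exists x, (rho c w); split=> //; apply/homAP => a m.
by have /lfunP/(_ m) := fE a; rewrite rhoE scale_lfunE.
Qed.

End Radical.

(** * One-dimensional bimodules *)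
Section Twist.
Variables (k : fieldType) (B : bound_quiver_algebra k).
Implicit Types (x y : vertex (bq_quiver B)) (a b : B).

Lemma env_homAP (M N : bimodule B) (f : 'Hom(M, N)) :
  reflect (forall a b v, f (lact (tens a b : env B) v) = lact (tens a b : env B) (f v))
          (f \in homA M N).
Proof.
apply: (iffP homAP) => [fA a b v|fA t v]; first exact: fA.
move: t; apply: eq_tens_linear => [c s t|c s t|a b]; last exact: fA.
  by rewrite lact_linl linearP.
by rewrite lact_linl.
Qed.

Section AtVertex.
Variable x : vertex (bq_quiver B).

Definition env_aug : env B -> B := tlift (fun a b => bq_aug x b *: a).

Lemma env_aug_linear : linear env_aug. Proof. exact: tlift_is_linear. Qed.

Lemma env_aug_tens a b : env_aug (tens a b) = bq_aug x b *: a.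
Proof.
apply: tlift_tens; split=> [v|u] c s t; first by rewrite scalerDr !scalerA mulrC.
by rewrite bq_aug_linear scalerDl scalerA.
Qed.

Lemma env_aug1 : env_aug 1 = 1.
Proof. by rewrite env_aug_tens bq_aug1 scale1r. Qed.

Lemma env_augM (s t : env B) : env_aug (s * t) = env_aug s * env_aug t.
Proof.
move: s; apply: eq_tens_linear => [c s s'|c s s'|a b].
- by rewrite mulrDl -scalerAl env_aug_linear.
- by rewrite env_aug_linear mulrDl scalerAl.
move: t; apply: eq_tens_linear => [c t t'|c t t'|a' b'].
- by rewrite mulrDr -scalerAr env_aug_linear.
- by rewrite env_aug_linear mulrDr scalerAr.
by rewrite env_mulE !env_aug_tens bq_augM -scalerAl -scalerAr scalerA mulrC.
Qed.

Variable N : lmodule B.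
Definition twist_act (t : env B) (v : N) : N := lact (env_aug t) v.
Lemma twist_act_linl v : linear (twist_act^~ v).
Proof. by move=> c s t; rewrite /twist_act env_aug_linear lact_linl. Qed.
Lemma twist_act_linr t : linear (twist_act t).
Proof. by move=> c u v; rewrite /twist_act lact_linr. Qed.
Lemma twist_act1 v : twist_act 1 v = v.
Proof. by rewrite /twist_act env_aug1 lact1. Qed.
Lemma twist_actM s t v : twist_act (s * t) v = twist_act s (twist_act t v).
Proof. by rewrite /twist_act env_augM lactM. Qed.

(** Restriction of [N] along the algebra map [env_aug], which sends [a (x) b] to
    [bq_aug x b *: a]. It is right adjoint to tensoring with the simple left
    module at [x]. *)
Definition twist : bimodule B :=
  LModule twist_act_linl twist_act_linr twist_act1 twist_actM.

Lemma twistE a b v : lact (tens a b : env B) (v : twist) = bq_aug x b *: lact a v.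
Proof.
rewrite /= /twist_act env_aug_tens -[_ *: a]addr0 lact_linl.
by rewrite lact0l addr0.
Qed.
End AtVertex.

Definition simple_bimod y x : bimodule B := twist x (simple_left y).

Lemma simple_bimodE y x a b (c : k^o) :
  lact (tens a b : env B) (c : simple_bimod y x) = bq_aug y a * bq_aug x b * c :> k^o.
Proof. by rewrite twistE /= /simple_lact -[_ *: _]/(_ * _) mulrCA mulrA. Qed.

(** Take a functional that is an eigenvector for the left action, and then move it
    by the right action, which commutes with the left one, to an eigenvector for
    both. *)
Lemma bimod_top (M : bimodule B) (v : M) : v != 0 ->
  exists y x (f : 'Hom(M, simple_bimod y x)), f \in homA M (simple_bimod y x) /\ f != 0.
Proof.
rewrite -memv0 => /sep_functional[w nzw _].
pose rho (t : env B) (f : 'Hom(M, k^o)) : 'Hom(M, k^o) := (f \o lact_map M t)%VF.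
have rhoE t f m : rho t f m = f (lact t m) by rewrite comp_lfunE lfunE.
have rho_lin f : linear (rho^~ f).
  by move=> c a b; apply/lfunP => m; rewrite add_lfunE scale_lfunE !rhoE lact_linl linearP.
have rho1 f : rho (tens 1 1) f = f by apply/lfunP => m; rewrite rhoE lact1.
have rhoM s t f : rho (s * t) f = rho t (rho s f).
  by apply/lfunP => m; rewrite !rhoE lactM.
have nz0 : w != 0 by apply: contraNneq nzw => ->; rewrite lfunE.
have [|f||c [y [nz1 f1E]]] := @joint_eigenvector _ B _ (fun a => rho (tens a 1)) w _ _ _ nz0.
- by move=> f c a b; rewrite tens_linl rho_lin.
- exact: rho1.
- by right=> a b f; rewrite -rhoM env_mulE mulr1.
set w1 := rho _ w in nz1 f1E.
have [|f||d [x [nz2 f2E]]] := @joint_eigenvector _ B _ (fun b => rho (tens 1 b)) w1 _ _ _ nz1.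
- by move=> f c' a b; rewrite tens_linr rho_lin.
- exact: rho1.
- by left=> a b f; rewrite -rhoM env_mulE mulr1.
exists y, x, (rho (tens 1 d) w1); split=> //; apply/env_homAP => a b m.
rewrite simple_bimodE.
(* The second move keeps the left eigenvalue. *)
have f2y : rho (tens a 1) (rho (tens 1 d) w1) = bq_aug y a *: rho (tens 1 d) w1.
  have -> : rho (tens a 1) (rho (tens 1 d) w1) = rho (tens 1 d) (rho (tens a 1) w1).
    by rewrite -!rhoM !env_mulE !(mulr1, mul1r).
  by rewrite f1E /rho -comp_lfunZl.
have -> : (tens a b : env B) = (tens a 1 : env B) * (tens 1 b : env B).
  by rewrite env_mulE mulr1 mulr1.
rewrite -rhoE rhoM f2y.
transitivity ((bq_aug y a *: rho (tens 1 b) (rho (tens 1 d) w1)) m).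
  by rewrite !rhoE !scale_lfunE !rhoE.
by rewrite f2E !scale_lfunE scalerA.
Qed.
End Twist.

(** * Composition factors and maps out of a projective *)
Section Additivity.
Variables (k : fieldType) (A : falgType k).
Implicit Types (M X P S : lmodule A).

Lemma lact_mapE M a (v : M) : lact_map M a v = lact a v.
Proof. by rewrite lfunE. Qed.

Lemma dim_homA_ker P X S (f : 'Hom(X, S)) (fA : f \in homA X S) :
    projective P -> limg f = fullv ->
  \dim (homA P X) = (\dim (homA P (ker_mod fA)) + \dim (homA P S))%N.
Proof.
move=> Pproj fsurj; rewrite -(limg_ker_dim (postcomp P f) (homA P X)).
set iota := sub_incl (ker_lsubmodule fA).
have iotaA : iota \in homA (ker_mod fA) X by apply: sub_incl_hom.
have iotaE u : iota u = vsval (u : subvs_of (lker f)) := sub_inclE u.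
congr addn; last first.
  congr (\dim _); apply/vspaceP => h; apply/memv_imgP/idP => [[g gA ->]|hA].
    by rewrite postcompE homA_comp.
  by have [g gA <-] := Pproj _ _ _ _ fA fsurj hA; exists g; rewrite ?postcompE.
apply/esym/(@dim_bij _ _ _ _ _ (postcomp P iota)) => [g gA|g _|g].
- rewrite postcompE memv_cap homA_comp //= memv_ker postcompE; apply/eqP/lfunP => v.
  by rewrite !comp_lfunE iotaE zero_lfunE; apply/eqP; rewrite -memv_ker subvsP.
- rewrite postcompE => g0; apply/lfunP => v; apply: subvs_inj.
  by have /lfunP/(_ v) := g0; rewrite comp_lfunE iotaE !lfunE.
rewrite memv_cap memv_ker postcompE => /andP[gA /eqP fg0].
have gK v : g v \in lker f.
  by have /lfunP/(_ v) := fg0; rewrite comp_lfunE lfunE memv_ker /= => ->.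
have gE v : iota ((linfun (vsproj (lker f)) \o g)%VF v) = g v.
  by rewrite iotaE comp_lfunE lfunE /= vsprojK.
exists (linfun (vsproj (lker f)) \o g)%VF; last first.
  by apply/lfunP => v; rewrite postcompE comp_lfunE gE.
apply/homAP => a v; apply: subvs_inj; rewrite -!iotaE.
by rewrite [LHS]gE (homAP gA) -gE (homAP iotaA).
Qed.

(** Applying an idempotent is an exact functor. *)
Lemma dim_idem_ker X S (f : 'Hom(X, S)) (fA : f \in homA X S) (e : A) :
    e * e = e -> limg f = fullv ->
  \dim (limg (lact_map X e))
  = (\dim (limg (lact_map (ker_mod fA) e)) + \dim (limg (lact_map S e)))%N.
Proof.
move=> ee fsurj; rewrite -(limg_ker_dim f (limg (lact_map X e))).
set iota := sub_incl (ker_lsubmodule fA).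
have iotaA : iota \in homA (ker_mod fA) X by apply: sub_incl_hom.
have iotaE u : iota u = vsval (u : subvs_of (lker f)) := sub_inclE u.
congr addn; last first.
  congr (\dim _); apply/vspaceP => h; apply/memv_imgP/memv_imgP => [[_ /memv_imgP[v _ ->] ->]|].
    by exists (f v); rewrite ?memvf // !lact_mapE (homAP fA).
  case=> s _ ->; have [v <-] := (surjP f).1 fsurj s.
  by exists (lact_map X e v); rewrite ?memv_img ?memvf // !lact_mapE (homAP fA).
apply/esym/(@dim_bij _ _ _ _ _ iota) => [_ /memv_imgP[u _ ->]|u _|v].
- rewrite lact_mapE (homAP iotaA) memv_cap memv_ker (homAP fA).
  have -> : f (iota u) = 0 by apply/eqP; rewrite -memv_ker iotaE subvsP.
  rewrite linear0 eqxx andbT; apply/memv_imgP; exists (iota u); rewrite ?memvf //.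
  by rewrite lact_mapE.
- by rewrite iotaE => u0; apply: subvs_inj; rewrite u0 linear0.
rewrite memv_cap => /andP[/memv_imgP[x _ xE] vK].
have eV : lact e v = v by rewrite xE lact_mapE -lactM ee.
have iK : iota (vsproj (lker f) v) = v by rewrite iotaE vsprojK.
exists (vsproj (lker f) v) => //; apply/memv_imgP; exists (vsproj (lker f) v).
  exact: memvf.
by apply: subvs_inj; rewrite lact_mapE -!iotaE (homAP iotaA) iK eV.
Qed.
End Additivity.

Section CompositionSeries.
Variables (k : fieldType) (B : bound_quiver_algebra k).
Implicit Types (x y : vertex (bq_quiver B)) (X P : bimodule B).

Lemma line_surj (V : vectType k) (f : 'Hom(V, k^o)) : f != 0 -> limg f = fullv.
Proof.
move=> nz; apply/eqP; rewrite eqEdim subvf dimvf /dim /= lt0n dimv_eq0.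
apply: contra nz => /eqP f0; apply/eqP/lfunP => v.
by rewrite lfunE /=; apply/eqP; rewrite -memv0 -f0 memv_img ?memvf.
Qed.

Lemma corner_simple y x y' x' :
  \dim (corner (simple_bimod y' x') y x) = ((y == y') && (x == x')).
Proof.
have act v : lact (tens (bq_idem y) (bq_idem x) : env B) (v : simple_bimod y' x')
    = ((y == y') && (x == x'))%:R * v :> k^o.
  by rewrite simple_bimodE !aug_idem -natrM mulnb eq_sym [x' == x]eq_sym.
rewrite /corner; case: (_ && _) act => act.
  have -> : lact_map (simple_bimod y' x') (tens (bq_idem y) (bq_idem x) : env B) = \1%VF.
    by apply/lfunP => v; rewrite lact_mapE act mul1r id_lfunE.
  by rewrite lim1g dimvf.
have -> : lact_map (simple_bimod y' x') (tens (bq_idem y) (bq_idem x) : env B) = 0.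
  by apply/lfunP => v; rewrite lact_mapE act mul0r zero_lfunE.
by rewrite lim0g dimv0.
Qed.

Lemma corner_idem y x : (tens (bq_idem y) (bq_idem x) : env B) * tens (bq_idem y) (bq_idem x)
  = tens (bq_idem y) (bq_idem x).
Proof. by rewrite env_mulE !idem_mul !eqxx. Qed.

(** Both sides are additive along the kernel of a map onto a simple bimodule. *)
Lemma dim_homA_simples P X : projective P ->
  \dim (homA P X)
  = (\sum_y \sum_x \dim (corner X y x) * \dim (homA P (simple_bimod y x)))%N.
Proof.
move=> Pproj; have [d] := ubnP (\dim {: X}); elim: d X => // d IHd X leX.
have [[v nz]|X0] := pselect (exists v : X, v != 0); last first.
  have X0' (v : X) : v = 0 by apply/eqP; apply: contraT => nz; case: X0; exists v.
  have -> : homA P X = 0%VS.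
    apply/eqP; rewrite -subv0; apply/subvP => f _; rewrite memv0; apply/eqP/lfunP => v.
    exact: etrans (X0' _) (esym (X0' _)).
  rewrite dimv0 big1 // => y _; rewrite big1 // => x _.
  suff -> : corner X y x = 0%VS by rewrite dimv0.
  by apply/eqP; rewrite -subv0; apply/subvP => v _; rewrite memv0 [v]X0'.
have [y [x [f [fA nzf]]]] := bimod_top nz.
have fsurj : limg f = fullv := line_surj nzf.
have ltd : (\dim {: ker_mod fA} < d)%N.
  have := limg_ker_dim f fullv; rewrite capfv fsurj => dX.
  move: leX; rewrite -dX ltnS; apply: leq_trans.
  have -> : \dim {: simple_bimod y x} = 1%N by rewrite dimvf.
  by rewrite [\dim {: ker_mod fA}]dimvf addn1.
rewrite (dim_homA_ker fA Pproj fsurj) (IHd _ ltd).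
under [RHS]eq_bigr => y' _ do under eq_bigr => x' _ do
  rewrite /corner (dim_idem_ker fA (corner_idem y' x') fsurj) -!/(corner _ _ _)
    corner_simple mulnDl.
under [RHS]eq_bigr => y' _ do rewrite big_split.
rewrite big_split /=; congr addn.
rewrite (bigD1 y) //= (bigD1 x) //= !eqxx mul1n !big1 ?addn0 //.
  by move=> y' /negPf ->; rewrite big1.
by move=> x' /negPf ->; rewrite andbF.
Qed.
End CompositionSeries.

(** * Projective covers and one-dimensional targets *)
Section Minimality.
Variables (k : fieldType) (A : falgType k).
Implicit Types (M N X P S : lmodule A).

Lemma homA_factor M N S (q : 'Hom(M, N)) (g : 'Hom(M, S)) :
    q \in homA M N -> limg q = fullv -> g \in homA M S ->
    (forall v, v \in lker q -> g v = 0) ->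
  exists2 h, h \in homA N S & (h \o q)%VF = g.
Proof.
move=> /homAP qA qsurj /homAP gA g0.
have hK v : g (q^-1%VF (q v)) = g v.
  apply/eqP; rewrite -subr_eq0 -linearB; apply/eqP/g0.
  by rewrite memv_ker linearB /= limg_lfunVK ?subrr // memv_img ?memvf.
exists (g \o q^-1)%VF; last by apply/lfunP => v; rewrite !comp_lfunE hK.
apply/homAP => a w; have [v <-] := (surjP q).1 qsurj w.
by rewrite !comp_lfunE -qA !hK.
Qed.

(** If [f] were non-zero at some vector of the superfluous kernel [K], then
    [lker f + K] would be everything, since the image of [f] is a line. *)
Lemma cover_hom_line M S (f : 'Hom(pcover M, S)) : \dim {: S} = 1%N ->
    f \in homA (pcover M) S ->
  forall v, v \in lker (pc_map (pcover M)) -> f v = 0.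
Proof.
move=> dS fA v Kv; apply/eqP; apply: contraT => nz.
have: v \in lker f; last by rewrite memv_ker (negPf nz).
have -> : lker f = fullv; last exact: memvf.
apply: (@pc_min _ _ _ (pcover M)); first exact: (ker_lsubmodule fA).
apply/vspaceP => u; rewrite memvf.
have: f u \in <[f v]>%VS.
  suff -> : <[f v]>%VS = fullv by rewrite memvf.
  by apply/eqP; rewrite eqEdim subvf dS dim_vline nz.
case/vlineP=> c fuE; apply/memv_addP; exists (u - c *: v); last first.
  by exists (c *: v); rewrite ?memvZ ?subrK.
by rewrite memv_ker linearB linearZ /= fuE subrr.
Qed.

Lemma dim_homA_surj M N S (q : 'Hom(M, N)) :
    q \in homA M N -> limg q = fullv ->
    (forall g, g \in homA M S -> forall v, v \in lker q -> g v = 0) ->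
  \dim (homA M S) = \dim (homA N S).
Proof.
move=> qA qsurj q0; apply/esym/(@dim_bij _ _ _ _ _ (precomp S q)) => [h hA|h _|g gA].
- by rewrite precompE homA_comp.
- rewrite precompE => h0; apply/lfunP => w; have [v <-] := (surjP q).1 qsurj w.
  by rewrite -comp_lfunE h0 !zero_lfunE.
have [h hA hq] := homA_factor qA qsurj gA (q0 _ gA).
by exists h; rewrite ?precompE.
Qed.

Lemma dim_homA_cover M S : \dim {: S} = 1%N ->
  \dim (homA (pcover M) S) = \dim (homA M S).
Proof.
move=> dS; apply: (dim_homA_surj (pc_hom (pcover M)) (pc_surj _)) => g.
exact: cover_hom_line.
Qed.

(** By minimality, all differentials of the complex of maps into [S] vanish. *)
Lemma dim_Ext_line n M S : \dim {: S} = 1%N ->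
  vdim (Ext n M S) = \dim (homA (res M n) S).
Proof.
move=> dS.
have rank0 i : cochain_rank M S i = 0%N.
  apply/eqP; rewrite dimv_eq0 -subv0; apply/subvP => _ /memv_imgP[f fA ->].
  rewrite memv0 precompE; apply/eqP/lfunP => v; rewrite comp_lfunE zero_lfunE.
  by apply: (cover_hom_line dS fA); rewrite -cover_d_exact memv_img ?memvf.
have := dim_Ext M S n; rewrite rank0 addn0 -/(cochain_dim M S n) => <-.
by case: (n) => [|i]; rewrite ?dimv0 ?addn0 // [X in (_ + X)%N]rank0 addn0.
Qed.
End Minimality.

(** * Bimodules that are projective as right modules *)
Section RightLinear.
Variables (k : fieldType) (A : falgType k).
Implicit Types (M N P Q : bimodule A).

Definition right_linear M N (f : 'Hom(M, N)) :=
  forall b v, f (lact (tens 1 b : env A) v) = lact (tens 1 b : env A) (f v).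

(** Lifting is only required against maps between bimodules, so that right modules
    need no separate type; this suffices to split off kernels. *)
Definition right_projective M := forall P N (g : 'Hom(P, N)) (f : 'Hom(M, N)),
  right_linear g -> limg g = fullv -> right_linear f ->
  exists2 h : 'Hom(M, P), right_linear h & (g \o h)%VF = f.

Lemma homA_right_linear M N (f : 'Hom(M, N)) : f \in homA M N -> right_linear f.
Proof. by move=> /homAP fA b v; apply: fA. Qed.

Lemma right_linear_comp M N P (g : 'Hom(N, P)) (f : 'Hom(M, N)) :
  right_linear g -> right_linear f -> right_linear (g \o f)%VF.
Proof. by move=> gr fr b v; rewrite !comp_lfunE fr gr. Qed.

Lemma right_projective_self : right_projective (self_bimod A).
Proof.
move=> P N g f gr gsurj fr; have [p gp] := (surjP g).1 gsurj (f (1 : A)).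
pose h (b : self_bimod A) : P := lact (tens 1 (b : A) : env A) p.
have hl : linear h by move=> c a b; rewrite /h tens_linr lact_linl.
have actE (a b : A) : lact (tens 1 b : env A) (a : self_bimod A) = a * b.
  by apply: etrans (self_act_tens 1 b a) _; rewrite mul1r.
exists (linfun h).
  move=> b v; rewrite !(linfunE hl) actE /h -lactM env_mulE mul1r.
  by [].
apply/lfunP => b; rewrite comp_lfunE (linfunE hl) /h gr gp -fr actE mul1r.
by [].
Qed.

Lemma right_projective_retract M P (i : 'Hom(M, P)) (r : 'Hom(P, M)) :
    right_linear i -> right_linear r -> (r \o i = \1)%VF ->
  right_projective P -> right_projective M.
Proof.
move=> ir rr ri Pr P' N g f gr gsurj fr.
have [h hr ghE] := Pr _ _ _ _ gr gsurj (right_linear_comp fr rr).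
exists (h \o i)%VF; first exact: right_linear_comp.
by rewrite comp_lfunA ghE -comp_lfunA ri comp_lfun1r.
Qed.

(** As a right module, the enveloping algebra is free on the elements [a (x) 1], so
    a lift may be chosen linearly in [a] and extended by right
    multiplication. *)
Lemma right_projective_free d : right_projective (free_mod (env A) d).
Proof.
move=> P N g f gr gsurj fr.
pose w i (a : A) : P := g^-1%VF (f (lact (tens a 1 : env A) (free_gen (env A) i))).
have gw i a : g (w i a) = f (lact (tens a 1 : env A) (free_gen (env A) i)).
  by rewrite /w limg_lfunVK // gsurj memvf.
pose H i : env A -> P := tlift (fun a b : A => lact (tens 1 b : env A) (w i a)).
have Hl i : linear (H i) by apply: tlift_is_linear.
have Htens i (a b : A) : H i (tens a b) = lact (tens 1 b : env A) (w i a).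
  apply: tlift_tens; split=> [b'|a'] c s t.
    by rewrite /w tens_linl lact_linl !linearP.
  by rewrite tens_linr lact_linl.
have gH i t : g (H i t) = f (lact t (free_gen (env A) i)).
  move: t; apply: eq_tens_linear => [c s t|c s t|a b].
  - by rewrite Hl linearP.
  - by rewrite lact_linl linearP.
  rewrite Htens gr gw -fr -lactM env_mulE mul1r mul1r.
  by [].
have HM i (b : A) t : H i ((tens 1 b : env A) * t) = lact (tens 1 b : env A) (H i t).
  move: t; apply: eq_tens_linear => [c s t|c s t|a b'].
  - by rewrite mulrDr -scalerAr Hl.
  - by rewrite Hl lact_linr.
  by rewrite env_mulE !Htens mul1r -lactM env_mulE mul1r.
pose h (v : free_mod (env A) d) : P := \sum_i H i ((v : {ffun 'I_d -> env A}) i).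
have hl : linear h.
  move=> c u v; rewrite /h scaler_sumr -big_split; apply: eq_bigr => i _ /=.
  by rewrite !ffunE Hl.
exists (linfun h).
  move=> b v; rewrite !(linfunE hl) /h linear_sum; apply: eq_bigr => i _.
  by rewrite ffunE HM.
apply/lfunP => v; rewrite comp_lfunE (linfunE hl) /h linear_sum.
have {2}-> : v = \sum_i lact ((v : {ffun _ -> _}) i) (free_gen (env A) i).
  apply/ffunP => j; rewrite sum_ffunE (bigD1 j) //= !ffunE eqxx mulr1 big1 ?addr0 //.
  by move=> i /negPf ne; rewrite !ffunE ne mulr0.
by rewrite linear_sum; apply: eq_bigr => i _; apply: gH.
Qed.

Lemma projective_right_projective P : projective P -> right_projective P.
Proof.
move=> Pproj; set d := \dim {: P}.
pose r := free_hom (fun i : 'I_d => (vbasis {: P})`_i).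
have idA : \1%VF \in homA P P by apply/homAP => a v; rewrite !lfunE.
have [i iA ri] := Pproj _ _ _ _ (free_homA _) (free_surj P) idA.
apply: (right_projective_retract (homA_right_linear iA) (homA_right_linear (free_homA _)) ri).
exact: right_projective_free.
Qed.

Lemma right_retraction M P (p : 'Hom(P, M)) (pA : p \in homA P M) :
    right_projective M -> limg p = fullv ->
  exists2 r : 'Hom(P, ker_mod pA), right_linear r
    & (r \o sub_incl (ker_lsubmodule pA) = \1)%VF.
Proof.
move=> Mr psurj; set iota := sub_incl _.
have iotaE u : iota u = vsval (u : subvs_of (lker p)) := sub_inclE u.
have iotaA : iota \in homA (ker_mod pA) P by apply: sub_incl_hom.
have id_right : right_linear (\1%VF : 'Hom(M, M)) by move=> b v; rewrite !id_lfunE.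
have [s sr ps] := Mr _ _ _ _ (homA_right_linear pA) psurj id_right.
pose e : 'Hom(P, P) := (\1 - (s \o p))%VF.
have eE v : e v = v - s (p v) by rewrite add_lfunE opp_lfunE id_lfunE comp_lfunE.
have eK v : e v \in lker p.
  by rewrite memv_ker eE linearB /= -(comp_lfunE p s) ps id_lfunE subrr.
pose r : 'Hom(P, ker_mod pA) := (linfun (vsproj (lker p)) \o e)%VF.
have rE v : iota (r v) = e v by rewrite iotaE comp_lfunE lfunE /= vsprojK.
have iota_inj : injective iota by move=> u v; rewrite !iotaE; apply: subvs_inj.
exists r.
  move=> b v; apply: iota_inj; rewrite rE (homAP iotaA) rE !eE linearB /=.
  by rewrite (homAP pA) sr.
apply/lfunP => u; apply: iota_inj; rewrite comp_lfunE id_lfunE rE eE.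
have : iota u \in lker p by rewrite iotaE subvsP.
by rewrite memv_ker => /eqP->; rewrite linear0 subr0.
Qed.

Lemma right_projective_ker M P (p : 'Hom(P, M)) (pA : p \in homA P M) :
    right_projective M -> right_projective P -> limg p = fullv ->
  right_projective (ker_mod pA).
Proof.
move=> Mr Pr psurj; have [r rr rK] := right_retraction pA Mr psurj.
apply: (right_projective_retract _ rr rK Pr).
exact/homA_right_linear/sub_incl_hom.
Qed.
End RightLinear.

(** * Tensoring bimodule syzygies with a simple left module *)
Section RightTop.
Variables (k : fieldType) (B : bound_quiver_algebra k) (x : vertex (bq_quiver B)).
Implicit Types (M P : bimodule B) (N R S : lmodule B).

Definition aug_form : 'Hom(B, k^o) := linfun (bq_aug x : B -> k^o).

Lemma aug_formE b : aug_form b = bq_aug x b.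
Proof. exact: linfunE (@bq_aug_linear _ _ x) b. Qed.

(** [M m], where [m] is the kernel of the augmentation at [x]; the quotient by it is
    the tensor product of [M] with the simple left module at [x]. *)
Definition right_rad M : {vspace M} :=
  (\sum_(i < \dim (lker aug_form))
     limg (lact_map M (tens 1 (vbasis (lker aug_form))`_i : env B)))%VS.

Lemma mem_right_rad M b v : bq_aug x b = 0 -> lact (tens 1 b : env B) v \in right_rad M.
Proof.
move=> b0; have Kb : b \in lker aug_form by rewrite memv_ker aug_formE b0.
have lin : linear (fun b => lact (tens 1 b : env B) v).
  by move=> c s t; rewrite tens_linr lact_linl.
rewrite (coord_vbasis Kb) (linear_sum_of lin); apply: rpred_sum => i _; apply: rpredZ.
rewrite memvE /right_rad (sumv_sup i) // -memvE -lact_mapE memv_img ?memvf //.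
Qed.

Lemma right_rad_sub M (U : {vspace M}) :
    (forall b v, bq_aug x b = 0 -> lact (tens 1 b : env B) v \in U) ->
  (right_rad M <= U)%VS.
Proof.
move=> KU; apply/subv_sumP => i _; apply/subvP => _ /memv_imgP[v _ ->].
rewrite lact_mapE; apply: KU; have : (vbasis (lker aug_form))`_i \in lker aug_form.
  by rewrite vbasis_mem // mem_nth // size_tuple.
by rewrite memv_ker aug_formE => /eqP.
Qed.

Lemma right_rad_lift M M' (p : 'Hom(M', M)) : p \in homA M' M -> limg p = fullv ->
  forall v, v \in right_rad M -> exists2 v', v' \in right_rad M' & p v' = v.
Proof.
move=> /homAP pA psurj v; have /subvP sub : (right_rad M <= p @: right_rad M')%VS.
  apply: right_rad_sub => b w b0; have [w' <-] := (surjP p).1 psurj w.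
  by rewrite -pA memv_img // mem_right_rad.
by move=> /sub/memv_imgP[v' v'K ->]; exists v'.
Qed.

Lemma right_linear_rad M M' (r : 'Hom(M, M')) : right_linear r ->
  forall v, v \in right_rad M -> r v \in right_rad M'.
Proof.
move=> rr v Kv; have /subvP sub : (right_rad M <= r @^-1: right_rad M')%VS.
  by apply: right_rad_sub => b w b0; rewrite -memv_preim rr mem_right_rad.
by rewrite memv_preim sub.
Qed.

Lemma right_rad_stable M a v : v \in right_rad M ->
  lact (tens a 1 : env B) v \in right_rad M.
Proof.
rewrite -lact_mapE; apply: right_linear_rad => b w.
by rewrite !lact_mapE -!lactM !env_mulE !(mul1r, mulr1).
Qed.

Lemma twist_lact1 N a (v : twist x N) : lact (tens a 1 : env B) v = lact a (v : N).
Proof. by rewrite twistE bq_aug1 scale1r. Qed.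

Lemma twist_homA N R (h : 'Hom(N, R)) : h \in homA N R ->
  (h : 'Hom(twist x N, twist x R)) \in homA (twist x N) (twist x R).
Proof. by move=> /homAP hA; apply/homAP => t v; apply: hA. Qed.

Lemma twist_rad M N (g : 'Hom(M, twist x N)) : g \in homA M (twist x N) ->
  forall v, v \in right_rad M -> g v = 0.
Proof.
move=> /homAP gA v Kv; apply/eqP; rewrite -memv_ker; move: v Kv; apply/subvP.
apply: right_rad_sub => b v b0.
by rewrite memv_ker gA twistE b0 scale0r.
Qed.

(** The map [q] exhibits [N] as the quotient of [M] by [right_rad M]. Stating this
    for a given [N], rather than for the quotient, lets the syzygies of the
    simple module play the role of [N]. *)
Definition right_top_map M N (q : 'Hom(M, twist x N)) :=
  [/\ q \in homA M (twist x N), limg q = fullv & (lker q <= right_rad M)%VS].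

Lemma right_top_factor M N S (q : 'Hom(M, twist x N)) (g : 'Hom(M, twist x S)) :
    right_top_map q -> g \in homA M (twist x S) ->
  exists2 h : 'Hom(N, S), h \in homA N S & forall v, h (q v) = g v.
Proof.
move=> [qA qsurj /subvP Kq] gA.
have [v Kv|h /homAP hA hq] := homA_factor qA qsurj gA; first exact: twist_rad (Kq _ Kv).
exists h => [|v]; last by rewrite -hq comp_lfunE.
apply/homAP => a v; have := hA (tens a 1) v.
by rewrite !twist_lact1.
Qed.

Lemma dim_homA_right_top M N S (q : 'Hom(M, twist x N)) : right_top_map q ->
  \dim (homA M (twist x S)) = \dim (homA N S).
Proof.
move=> qtop; have [qA qsurj _] := qtop.
apply/esym/(@dim_bij _ _ _ _ _ (precomp S q)) => [h hA|h _|g gA].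
- by rewrite precompE; exact: homA_comp (twist_homA hA) qA.
- rewrite precompE => h0; apply/lfunP => w; have [v <-] := (surjP q).1 qsurj w.
  by rewrite -[LHS](comp_lfunE h q) h0 !zero_lfunE.
have [h hA hq] := right_top_factor qtop gA.
by exists h; rewrite ?precompE //; apply/lfunP => v; rewrite comp_lfunE hq.
Qed.

Section Quotient.
Variable M : bimodule B.
Definition right_top_act (a : B) (q : vquot (right_rad M)) : vquot (right_rad M) :=
  vquot_proj (right_rad M) (lact (tens a 1 : env B) (vsval q)).

Lemma right_top_actE a v : right_top_act a (vquot_proj (right_rad M) v)
  = vquot_proj (right_rad M) (lact (tens a 1 : env B) v).
Proof.
apply/eqP; rewrite -subr_eq0 -linearB vquot_proj_eq0 -linearB right_rad_stable //.
by rewrite -opprB rpredN vquot_projK.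
Qed.

Lemma right_top_act_linl q : linear (right_top_act^~ q).
Proof. by move=> c a b; rewrite /right_top_act tens_linl lact_linl linearP. Qed.
Lemma right_top_act_linr a : linear (right_top_act a).
Proof. by move=> c u v; rewrite /right_top_act !linearP. Qed.
Lemma right_top_act1 q : right_top_act 1 q = q.
Proof. by rewrite /right_top_act lact1 vsvalQK. Qed.
Lemma right_top_actM a b q : right_top_act (a * b) q = right_top_act a (right_top_act b q).
Proof.
rewrite [right_top_act b q]/right_top_act right_top_actE -lactM env_mulE mulr1.
by [].
Qed.

Definition right_top : lmodule B :=
  LModule right_top_act_linl right_top_act_linr right_top_act1 right_top_actM.

Definition right_top_proj : 'Hom(M, twist x right_top) := vquot_proj (right_rad M).

Lemma right_top_projP : right_top_map right_top_proj.
Proof.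
split; last 1 first.
- by apply/subvP => v; rewrite memv_ker vquot_proj_eq0.
- apply/env_homAP => a b v; rewrite twistE.
  apply: etrans (congr1 _ (esym (right_top_actE a v))).
  rewrite -linearZ; apply/eqP; rewrite -subr_eq0 -linearB vquot_proj_eq0.
  have -> : lact (tens a b : env B) v - bq_aug x b *: lact (tens a 1 : env B) v
      = lact (tens 1 (b - bq_aug x b *: 1) : env B) (lact (tens a 1 : env B) v).
    have lin : linear (fun b => lact (tens 1 b : env B) (lact (tens a 1 : env B) v)).
      by move=> c s t; rewrite tens_linr lact_linl.
    rewrite [b - _]addrC -[- (_ *: 1)]scaleNr lin scaleNr addrC -!lactM !env_mulE.
    by rewrite !(mul1r, mulr1).
  apply: mem_right_rad; rewrite addrC -scaleNr bq_aug_linear bq_aug1.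
  by rewrite -[_ *: _]/(_ * _) mulr1 addNr.
exact: limg_vquot_proj.
Qed.
End Quotient.

Lemma right_top_self :
  right_top_map (aug_form : 'Hom(self_bimod B, twist x (simple_left x))).
Proof.
split.
- apply/env_homAP => a b v; rewrite twistE.
  rewrite [lact _ _](self_act_tens a b v) !aug_formE !bq_augM.
  by rewrite -[RHS]/(_ * (_ * _)) mulrC.
- apply/surjP => c; exists (c *: 1 : B).
  by rewrite linearZ /= aug_formE bq_aug1 -[LHS]/(_ * _) mulr1.
apply/subvP => v; rewrite memv_ker aug_formE => /eqP v0.
have -> : v = lact (tens 1 v : env B) (1 : self_bimod B).
  by apply: esym; apply: etrans (self_act_tens 1 v 1) _; rewrite !mul1r.
exact: mem_right_rad.
Qed.

(** Lift [q] to a map [t] between the covers: it is surjective because the kernel of the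
    cover of [N] is superfluous. It induces a surjection [tb] from
    [right_top P] onto the projective [pcover N], whose kernel [C] is then a direct
    summand. A map from [C] to a simple module extends to [right_top P], hence
    gives a map from [P] to a one-dimensional bimodule; by minimality
    this factors through [M], thus through [N], and so it vanishes on [C].
    Therefore [C = 0]. *)
Lemma right_top_cover M N (q : 'Hom(M, twist x N)) : right_top_map q ->
  exists t : 'Hom(pcover M, twist x (pcover N)), right_top_map t
    /\ forall v, pc_map (pcover N) (t v) = q (pc_map (pcover M) v).
Proof.
move=> qtop; have [qA qsurj _] := qtop.
set P := pc_mod (pcover M); set R := pc_mod (pcover N).
set p : 'Hom(P, M) := pc_map (pcover M); set r : 'Hom(R, N) := pc_map (pcover N).
have pA : p \in homA P M := pc_hom _; have psurj : limg p = fullv := pc_surj _.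
have rA : r \in homA R N := pc_hom _; have rsurj : limg r = fullv := pc_surj _.
have [t tA rt] := @pc_proj _ _ _ (pcover M) _ _ _ _ (twist_homA rA) rsurj (homA_comp qA pA).
have rtE v : r (t v) = q (p v).
  by have /lfunP/(_ v) := rt; rewrite !comp_lfunE.
exists t; split=> //.
have tsurj : limg t = fullv.
  apply: (@pc_min _ _ _ (pcover N)).
    move=> a _ /memv_imgP[v _ ->]; rewrite -twist_lact1 -(homAP tA).
    by rewrite memv_img ?memvf.
  apply/vspaceP => w; rewrite memvf.
  have [m mE] := (surjP q).1 qsurj (r w); have [v vE] := (surjP p).1 psurj m.
  apply/memv_addP; exists (t v); rewrite ?memv_img ?memvf //.
  exists (w - t v); last by rewrite addrC subrK.
  by rewrite memv_ker linearB /= -/r rtE vE mE subrr.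
split=> //; apply/subvP => v tv0.
have [piA pisurj _] := right_top_projP P; set pi := right_top_proj P in piA pisurj.
rewrite -(vquot_proj_eq0 (right_rad P)) -[vquot_proj _ v]/(pi v).
have [tb tbA tbE] := right_top_factor (right_top_projP P) tA.
have tbsurj : limg tb = fullv.
  by apply/surjP => w; have [u <-] := (surjP t).1 tsurj w; exists (pi u); rewrite -tbE.
have idA : \1%VF \in homA R R by apply/homAP => a u; rewrite !lfunE.
have [s sA tbs] := @pc_proj _ _ _ (pcover N) _ _ _ _ tbA tbsurj idA.
apply: contraT => nz.
have Cv : pi v \in lker tb by rewrite memv_ker tbE -memv_ker.
pose C := ker_mod tbA; pose c : C := vsproj (lker tb) (pi v).
have nzc : c != 0.
  by apply: contraNneq nz => /(congr1 vsval); rewrite /= vsprojK ?linear0 // => ->.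
have [y [f [fA]]] := left_top nzc; case/eqP.
set iota := sub_incl (ker_lsubmodule tbA).
have iotaE u : iota u = vsval (u : subvs_of (lker tb)) := sub_inclE u.
have iotaA : iota \in homA C (right_top P) by apply: sub_incl_hom.
pose e0 : 'End(right_top P) := (\1 - (s \o tb))%VF.
have e0E u : e0 u = u - s (tb u) by rewrite add_lfunE opp_lfunE id_lfunE comp_lfunE.
have e0K u : e0 u \in lker tb.
  by rewrite memv_ker e0E linearB /= -(comp_lfunE tb s) tbs id_lfunE subrr.
pose e : 'Hom(right_top P, C) := (linfun (vsproj (lker tb)) \o e0)%VF.
have eE u : iota (e u) = e0 u by rewrite iotaE comp_lfunE lfunE /= vsprojK.
have eA : e \in homA (right_top P) C.
  apply/homAP => a u; apply: subvs_inj; rewrite -!iotaE (homAP iotaA) !eE !e0E.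
  by rewrite (homAP tbA) (homAP sA) linearB.
have feA : (f \o e)%VF \in homA (right_top P) (simple_left y) := homA_comp fA eA.
have fepiA := homA_comp (twist_homA feA) piA.
have d1 : \dim {: simple_bimod y x} = 1%N by rewrite dimvf.
have [h hA hp] := homA_factor pA psurj fepiA (cover_hom_line d1 fepiA).
have [h' h'A h'q] := right_top_factor qtop hA.
(* On [right_top P] the map [f \o e] factors through [tb], which kills [C]. *)
have key u : f (e u) = h' (r (tb u)).
  have [w <-] := (surjP pi).1 pisurj u.
  by rewrite tbE rtE h'q -(comp_lfunE h p) hp !comp_lfunE.
apply/lfunP => u; rewrite zero_lfunE.
have tu0 : tb (iota u) = 0 by apply/eqP; rewrite -memv_ker iotaE subvsP.
have <- : e (iota u) = u.
  by apply: subvs_inj; rewrite -!iotaE eE e0E tu0 linear0 subr0.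
by rewrite key tu0 !linear0.
Qed.

(** Restrict [t] to the kernels of the covers. Surjectivity is a diagram chase
    based on [right_rad_lift]. For the kernel, one needs that an element of
    [right_rad P] lying in the syzygy is in the [right_rad] of the syzygy: apply
    a right linear retraction of [P] onto it. *)
Lemma right_top_syzygy M N (q : 'Hom(M, twist x N)) :
    right_projective M -> right_top_map q ->
  exists q' : 'Hom(syzygy1 M, twist x (syzygy1 N)), right_top_map q'.
Proof.
move=> Mr qtop; have [t [[tA tsurj Kt] rtE]] := right_top_cover qtop.
have [qA qsurj Kq] := qtop.
set P := pc_mod (pcover M) in t tA tsurj Kt rtE.
set R := pc_mod (pcover N) in t tA tsurj Kt rtE.
set p : 'Hom(P, M) := pc_map (pcover M) in rtE.
set r : 'Hom(R, N) := pc_map (pcover N) in rtE.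
have pA : p \in homA P M := pc_hom _; have psurj : limg p = fullv := pc_surj _.
have rA : r \in homA R N := pc_hom _.
set iP := sub_incl (ker_lsubmodule pA); set iR := sub_incl (ker_lsubmodule rA).
have iPE u : iP u = vsval (u : subvs_of (lker p)) := sub_inclE u.
have iRE u : iR u = vsval (u : subvs_of (lker r)) := sub_inclE u.
have iPA : iP \in homA (ker_mod pA) P by apply: sub_incl_hom.
have iRA : iR \in homA (ker_mod rA) R by apply: sub_incl_hom.
have iP_inj : injective iP by move=> u v; rewrite !iPE; apply: subvs_inj.
have iR_inj : injective iR by move=> u v; rewrite !iRE; apply: subvs_inj.
have piP u : p (iP u) = 0 by apply/eqP; rewrite -memv_ker iPE subvsP.
pose q' : 'Hom(ker_mod pA, twist x (ker_mod rA)) := (linfun (vsproj (lker r)) \o (t \o iP))%VF.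
have q'E u : iR (q' u) = t (iP u).
  rewrite iRE !comp_lfunE lfunE /= -/iP vsprojK //.
  by rewrite memv_ker rtE piP linear0.
exists q'; split.
- apply/env_homAP => a b u; apply: iR_inj; rewrite q'E (homAP iPA) (homAP tA) !twistE.
  by rewrite linearZ /= (homAP iRA) q'E.
- apply/surjP => n; have [v vE] := (surjP t).1 tsurj (iR n).
  have Kpv : p v \in right_rad M.
    apply: (subvP Kq); rewrite memv_ker -rtE vE -memv_ker iRE; exact: subvsP.
  have [v' Kv' pv'] := right_rad_lift pA psurj Kpv.
  have Kvv : v - v' \in lker p by rewrite memv_ker linearB /= pv' subrr.
  exists (vsproj (lker p) (v - v')); apply: iR_inj; rewrite q'E iPE vsprojK //.
  by rewrite linearB /= vE (twist_rad tA Kv') subr0.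
apply/subvP => u; rewrite memv_ker => /eqP u0.
have [rho rhor rhoK] := right_retraction pA Mr psurj.
have -> : u = rho (iP u) by rewrite -(comp_lfunE rho iP) rhoK id_lfunE.
apply: (right_linear_rad rhor); apply: (subvP Kt).
by rewrite memv_ker -q'E u0 linear0.
Qed.

Lemma right_top_syzygies n :
  right_projective (syzygy n (self_bimod B)) /\
  exists q : 'Hom(syzygy n (self_bimod B), twist x (syzygy n (simple_left x))),
    right_top_map q.
Proof.
elim: n => [|n [IHr [q qtop]]].
  by split; [apply: right_projective_self | exists aug_form; apply: right_top_self].
split; last exact: (right_top_syzygy IHr qtop).
apply: right_projective_ker => //; last exact: pc_surj.
exact/projective_right_projective/(@pc_proj _ _ _ (pcover _)).
Qed.
End RightTop.

(** * Dimensions of tau-Hochschild homology and cohomology *)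
Section TauHochschild.
Variables (k : fieldType) (B : bound_quiver_algebra k).
Implicit Types (x y : vertex (bq_quiver B)) (X : bimodule B).

Lemma dim_homA_res_simple i y x :
  \dim (homA (res (self_bimod B) i) (simple_bimod y x))
  = vdim (Ext i (simple_left x) (simple_left y)).
Proof.
have [_ [q qtop]] := right_top_syzygies x i.
rewrite dim_Ext_line ?dimvf // !dim_homA_cover ?dimvf //.
exact: dim_homA_right_top qtop.
Qed.

Lemma cochain_dim_self i X :
  cochain_dim (self_bimod B) X i
  = (\sum_x \sum_y \dim (corner X y x) * vdim (Ext i (simple_left x) (simple_left y)))%N.
Proof.
rewrite exchange_big; apply: etrans (dim_homA_simples X (@res_proj _ _ _ _)) _.
by apply: eq_bigr => y _; apply: eq_bigr => x _; rewrite dim_homA_res_simple.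
Qed.

Lemma dim_homA_tau_self n X : (0 < n)%N ->
  (\dim (homA X (tau_ n (self_bimod B))))%:Z
  = (-1) ^+ n *
    (\sum_(i < n) (-1) ^+ i.+1 * (vdim (HHcoh i X))%:Z
     + \sum_(i < n.+1) \sum_x \sum_y (-1) ^+ i * (\dim (corner X y x))%:Z
         * (vdim (Ext i (simple_left x) (simple_left y)))%:Z).
Proof.
case: n => // n _.
have <- : \sum_(i < n.+2) (-1) ^+ i * (cochain_dim (self_bimod B) X i)%:Z
  = \sum_(i < n.+2) \sum_x \sum_y (-1) ^+ i * (\dim (corner X y x))%:Z
         * (vdim (Ext i (simple_left x) (simple_left y)))%:Z.
  apply: eq_bigr => i _; rewrite cochain_dim_self (big_morph Posz PoszD (erefl _)) mulr_sumr.
  apply: eq_bigr => x _; rewrite (big_morph Posz PoszD (erefl _)) mulr_sumr.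
  by apply: eq_bigr => y _; rewrite PoszM mulrA.
rewrite -euler_telescope /cochain_dim.
by rewrite -(dim_homA_tau (syzygy n (self_bimod B)) X) PoszD addrK.
Qed.

Lemma dim_Tor_simple i y x :
  vdim (Tor i (simple_right y) (simple_left x)) = vdim (Ext i (simple_left x) (simple_left y)).
Proof.
rewrite dim_Tor_Ext; pose g (f : dual_mod (simple_right y)) : simple_left y :=
  (f : 'Hom(k^o, k^o)) 1.
have gl : linear g by move=> c f f'; rewrite /g add_lfunE scale_lfunE.
have f1E (f : 'Hom(k^o, k^o)) c : f c = c * f 1 by rewrite -[c in LHS]mulr1 linearZ.
apply: (@dim_Ext_iso _ _ _ _ _ _ (linfun g)).
- apply/homAP => a f; rewrite !(linfunE gl) {1}/g.
  apply: etrans (dual_actE (N := simple_right y) _ _ _) _.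
  by rewrite f1E /= /simple_ract mul1r.
- apply/eqP; rewrite -subv0; apply/subvP => f; rewrite memv_ker memv0 (linfunE gl) => /eqP f1.
  by apply/eqP/lfunP => c; rewrite f1E [_ 1]f1 mulr0 zero_lfunE.
apply/surjP => c; exists (c *: \1 : 'Hom(k^o, k^o))%VF.
by rewrite (linfunE gl) /g scale_lfunE id_lfunE -[LHS]/(_ * _) mulr1.
Qed.

Lemma corner_dual X y x : \dim (corner (bimod_dual X) y x) = \dim (corner X x y).
Proof.
rewrite /corner -[RHS]rank_precomp; congr (\dim (limg _)).
apply/lfunP => f; rewrite lact_mapE precompE; apply/lfunP => v.
by rewrite bimod_dualE comp_lfunE lact_mapE.
Qed.
End TauHochschild.

Unset Implicit Arguments.

Theorem theorem4p5 (k : fieldType) (B : bound_quiver_algebra k)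
    (X : bimodule B) (n : nat) (n_gt0 : (0 < n)%N) :
  [/\ (vdim (tauHHcoh n X))%:Z
      = (-1) ^+ n *
        (\sum_(i < n) (-1) ^+ i.+1 * (vdim (HHcoh i X))%:Z
         + \sum_(i < n.+1) \sum_(x : vertex (bq_quiver B)) \sum_(y : vertex (bq_quiver B))
             (-1) ^+ i * (\dim (corner X y x))%:Z
             * (vdim (Tor i (simple_right y) (simple_left x)))%:Z),
      (vdim (tauHHcoh n X))%:Z
      = (-1) ^+ n *
        (\sum_(i < n) (-1) ^+ i.+1 * (vdim (HHcoh i X))%:Z
         + \sum_(i < n.+1) \sum_(x : vertex (bq_quiver B)) \sum_(y : vertex (bq_quiver B))
             (-1) ^+ i * (\dim (corner X y x))%:Z
             * (vdim (Ext i (simple_left x) (simple_left y)))%:Z),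
      (vdim (tauHHhom n X))%:Z
      = (-1) ^+ n *
        (\sum_(i < n) (-1) ^+ i.+1 * (vdim (HHhom i X))%:Z
         + \sum_(i < n.+1) \sum_(x : vertex (bq_quiver B)) \sum_(y : vertex (bq_quiver B))
             (-1) ^+ i * (\dim (corner X y x))%:Z
             * (vdim (Tor i (simple_right x) (simple_left y)))%:Z)
    & (vdim (tauHHhom n X))%:Z
      = (-1) ^+ n *
        (\sum_(i < n) (-1) ^+ i.+1 * (vdim (HHhom i X))%:Z
         + \sum_(i < n.+1) \sum_(x : vertex (bq_quiver B)) \sum_(y : vertex (bq_quiver B))
             (-1) ^+ i * (\dim (corner X y x))%:Z
             * (vdim (Ext i (simple_left y) (simple_left x)))%:Z)].
Proof.
have cohE : vdim (tauHHcoh n X) = \dim (homA X (tau_ n (self_bimod B))).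
  by rewrite /vdim dim_dual dimvf.
have homE : vdim (tauHHhom n X) = \dim (homA (bimod_dual X) (tau_ n (self_bimod B))).
  by rewrite /vdim dimvf.
have cohF := dim_homA_tau_self X n_gt0.
have homF := dim_homA_tau_self (bimod_dual X) n_gt0.
have {}homF : (\dim (homA (bimod_dual X) (tau_ n (self_bimod B))))%:Z
  = (-1) ^+ n *
    (\sum_(i < n) (-1) ^+ i.+1 * (vdim (HHhom i X))%:Z
     + \sum_(i < n.+1) \sum_(x : vertex (bq_quiver B)) \sum_(y : vertex (bq_quiver B))
         (-1) ^+ i * (\dim (corner X y x))%:Z
         * (vdim (Ext i (simple_left y) (simple_left x)))%:Z).
  rewrite homF; congr (_ * (_ + _)).
    by apply: eq_bigr => i _; rewrite /HHhom dim_Tor_Ext.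
  apply: eq_bigr => i _; rewrite exchange_big; apply: eq_bigr => x _.
  by apply: eq_bigr => y _; rewrite corner_dual.
rewrite cohE homE; split=> //; [rewrite cohF | rewrite homF]; congr (_ * (_ + _));
  apply: eq_bigr => i _; apply: eq_bigr => x _; apply: eq_bigr => y _;
  by rewrite dim_Tor_simple.
Qed.
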